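(* Let $d=2$ and consider the i.i.d. environment $\mathcal{G}$ with $\mu(\{-e_1,e_1,-e_2\})=p$ and $\mu(\{e_2\})=1-p$. If $p^3-p^2+2p-1>0$ and $p<1$, then $\mathcal{G}$ has a gigantic $\mathcal{M}$-component almost surely. In consequence, the critical probability $p_c^{F}$ of the five-neighbour oriented site percolation model defined in the context satisfies $p_c^{F}\ge 0.4301$.
   Context: Let $e_1,e_2$ be the standard basis of $\mathbb{Z}^2$, $\mathcal{E}=\{\pm e_1,\pm e_2\}$, and $o$ the origin. Given a probability measure $\mu$ on the power set of $\mathcal{E}$ (with $\mu(A)$ short for $\mu(\{A\})$), the environment $\mathcal{G}=(\mathcal{G}_x)_{x\in\mathbb{Z}^2}$ is a family of i.i.d. random subsets of $\mathcal{E}$ with law $\mu$. Write $x\to y$ if there are $n\ge 0$ and $x=x_0,\dots,x_n=y$ with $x_{i+1}-x_i\in\mathcal{G}_{x_i}$ for $0\le i<n$. Let $\mathcal{M}_x=\{y: x\to y\text{ and }y\to x\}$. The environment $\mathcal{G}$ has a gigantic $\mathcal{M}$-component if there is an $x$ such that $\mathcal{M}_x$ is infinite and all connected components (with respect to nearest-neighbour adjacency in $\mathbb{Z}^2$) of $\mathbb{Z}^2\setminus\mathcal{M}_x$ are finite. Five-neighbour oriented site percolation with parameter $q$: each vertex of $\mathbb{Z}^2$ is independently open with probability $q$ and closed otherwise; an open vertex $x$ has directed edges to exactly $x-e_1$, $x+e_2$, $x-e_1+e_2$, $x-e_2$, $x-e_1-e_2$; closed vertices have no outgoing edges. The model is monotone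 in $q$; $p_c^{F}$ is the critical value such that the set of vertices reachable from $o$ by directed paths is a.s. finite if $q<p_c^{F}$ and infinite with positive probability if $q>p_c^{F}$. *)

(* Defs.v *)
From HB Require Import structures.
From mathcomp Require Import all_boot all_order all_algebra.
From mathcomp Require Import all_classical all_reals all_analysis.

Set Implicit Arguments.
Unset Strict Implicit.
Unset Printing Implicit Defensive.

Import Order.TTheory GRing.Theory Num.Theory.

Local Open Scope classical_set_scope.
Local Open Scope ring_scope.

Notation Z2 := (int * int)%type.

Definition e1 : Z2 := (1, 0).
Definition e2 : Z2 := (0, 1).

Definition units : seq Z2 := [:: e1; - e1; e2; - e2].

(* The set of the four unit vectors, as a finite subtype of Z2; a local
   environment is an element of {set dir}. *)
Definition dir := seq_sub units.

Definition dirset (s : seq Z2) : {set dir} := [set u : dir | val u \in s]%SET.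

Definition reaches (e : Z2 -> Z2 -> Prop) (x y : Z2) : Prop :=
  exists (n : nat) (z : nat -> Z2),
    [/\ z 0%N = x, z n = y & forall i, (i < n)%N -> e (z i) (z i.+1)].

Definition arc (G : Z2 -> {set dir}) (x y : Z2) : Prop :=
  exists2 u : dir, u \in G x & y - x = val u.

Definition mutual (G : Z2 -> {set dir}) (x : Z2) : set Z2 :=
  [set y | reaches (arc G) x y /\ reaches (arc G) y x].

Definition adjacent_in (A : set Z2) (x y : Z2) : Prop :=
  [/\ A x, A y & y - x \in units].

Definition component (A : set Z2) (x : Z2) : set Z2 :=
  [set y | reaches (adjacent_in A) x y].

Definition has_gigantic_component (G : Z2 -> {set dir}) : Prop :=
  exists x, infinite_set (mutual G x) /\
    forall y, (~` mutual G x) y -> finite_set (component (~` mutual G x) y).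

Definition is_pmf (R : realType) (T : finType) (mu : T -> R) : Prop :=
  (forall t, 0 <= mu t) /\ \sum_(t : T) mu t = 1.

(* X is an i.i.d. family of T-valued random variables with law mu; T carries
   the discrete sigma-algebra, so the events are {X x \in B} with B : {set T},
   and independence is the product rule over finite sets of vertices. *)
Definition iid_family (R : realType) (d : measure_display)
    (Omega : measurableType d) (P : probability Omega R)
    (T : finType) (mu : T -> R) (X : Z2 -> Omega -> T) : Prop :=
  [/\ forall x (B : {set T}), measurable [set w | X x w \in B],
      forall x (B : {set T}),
        P [set w | X x w \in B] = (\sum_(t in B) mu t)%:E
    & forall (s : seq Z2) (B : Z2 -> {set T}), uniq s ->
        P [set w | forall x, x \in s -> X x w \in B x] =
        (\prod_(x <- s) P [set w | X x w \in B x])%E].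

Definition five_steps : seq Z2 :=
  [:: - e1; e2; - e1 + e2; - e2; - e1 - e2].

Definition five_arc (opn : Z2 -> bool) (x y : Z2) : Prop :=
  opn x /\ y - x \in five_steps.

Definition five_cluster (opn : Z2 -> bool) : set Z2 :=
  [set y | reaches (five_arc opn) 0 y].

Definition five_as_finite (R : realType) (q : R) : Prop :=
  forall (d : measure_display) (Omega : measurableType d)
    (P : probability Omega R) (opn : Z2 -> Omega -> bool),
    iid_family P (bernoulli_pmf q) opn ->
    {ae P, forall w, finite_set (five_cluster (opn ^~ w))}.

Definition five_percolates (R : realType) (q : R) : Prop :=
  exists (d : measure_display) (Omega : measurableType d)
    (P : probability Omega R) (opn : Z2 -> Omega -> bool),
    iid_family P (bernoulli_pmf q) opn /\
    (0 < P [set w | infinite_set (five_cluster (opn ^~ w))])%E.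

(* The law of the cluster depends only on q, not on the probability space that
   carries the model, so the quantifier over realizations (all of them in
   five_as_finite, some of them in five_percolates) is immaterial. *)
Definition five_critical_value (R : realType) (pc : R) : Prop :=
  0 <= pc <= 1 /\
  forall q : R, 0 <= q <= 1 ->
    (q < pc -> five_as_finite q) /\ (pc < q -> five_percolates q).

(* Main.v *)
Require Import Defs.
From HB Require Import structures.
From mathcomp Require Import all_boot all_order all_algebra.
From mathcomp Require Import all_classical all_reals all_analysis.
From mathcomp Require Import zify ring lra.

(** Call a vertex up if its environment is {e2} and write q = 1 - p.  A walk
that goes up at up vertices, and otherwise goes down as long as the vertex
below is not up and then sideways, always in the same direction, sees a fresh
column at each sideways step.  Its height changes in a column by +j with
probability q^j p (j >= 1) and by -j with probability p^(j+1) q (j >= 0), and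
the drift is negative exactly when p^3 - p^2 + 2p - 1 > 0.  A Chernoff bound
and Borel-Cantelli then show that almost surely, for all large n, all walks
started in a box of size 1000 n^5 descend over every n columns, while straight
runs in this box have length less than n.

At such a scale n a westward walk A that starts high up, followed from its end
e by an eastward walk B, forms a wedge around the box of size n, which is closed
on the right by an ascending path U confined to the columns between n^2 and
n^2 + n (each row has an up vertex there).  Following A to e, then B, then U,
and back to A, one sees that the parts that bound the region are mutually
connected to e.  As U also crosses the curves A and B of scale n + 1, all
these circuits lie in one component.

In the five-neighbour model an infinite cluster has a path of open (up)
vertices from o to a far column on the left.  The environment cannot cross such
a path downwards, but a westward walk from o followed by an eastward walk back
to column 0 would end far below o: the path meets column 0 in a long vertical
run of open vertices, a contradiction. *)

Set Implicit Arguments.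
Unset Strict Implicit.
Unset Printing Implicit Defensive.

Import Order.TTheory GRing.Theory Num.Theory.
Local Open Scope classical_set_scope.
Local Open Scope ring_scope.

Implicit Types (v z : Z2) (c h : int).

(** * Crossings of lattice paths *)

Lemma int_ivt (f : nat -> int) (a b : nat) (t : int) : (a <= b)%N ->
  (forall i, (a <= i < b)%N -> f i.+1 <= f i + 1) -> f a <= t <= f b ->
  exists2 i, (a <= i <= b)%N & f i = t.
Proof.
move=> + fS; elim: b fS => [|b IH] fS ab tab; first by have E : a = 0%N by [lia]; exists a; [lia | move: tab; rewrite E; lia].
have [E|ltab] := eqVneq a b.+1; first by exists a; [lia | move: tab; rewrite -E; lia].
have [tb|tb] := leP t (f b); last first.
  by exists b.+1; [lia | have := fS b; lia].
have [| | |i ib fi] := IH; [by move=> i ib; apply: fS; lia|lia|lia|].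
by exists i; [lia|].
Qed.

Lemma Z2_eq (u v : Z2) : u.1 = v.1 -> u.2 = v.2 -> u = v.
Proof. by case: u v => [? ?] [? ?] /= -> ->. Qed.

(* King's-move adjacency: five-neighbour paths have diagonal steps. *)
Definition king (u v : Z2) : bool :=
  [&& v.1 - u.1 <= 1, u.1 - v.1 <= 1, v.2 - u.2 <= 1 & u.2 - v.2 <= 1].

Definition nn (u v : Z2) : Prop := king u v /\ (u.1 = v.1 \/ u.2 = v.2).

Definition kpath (w : nat -> Z2) m := forall i, (i < m)%N -> king (w i) (w i.+1).
Definition nnpath (w : nat -> Z2) m := forall i, (i < m)%N -> nn (w i) (w i.+1).

(* Holds for paths along which the column is monotone; such a path cuts every
   column in an interval, so it has an upper and a lower side. *)
Definition fibered (w : nat -> Z2) m := forall i j k, (i <= j <= k)%N ->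
  (k <= m)%N -> (w i).1 = (w k).1 -> (w j).1 = (w i).1.

Definition on (w : nat -> Z2) m z := exists2 i, (i <= m)%N & w i = z.
Definition visits (w : nat -> Z2) m (c : int) := exists2 i, (i <= m)%N & (w i).1 = c.
(** Both [above] and [below] hold vacuously in a column that the path misses, hence the [visits]
    hypotheses in later lemmas. *)
Definition above (w : nat -> Z2) m (z : Z2) :=
  forall i, (i <= m)%N -> (w i).1 = z.1 -> (w i).2 < z.2.
Definition below (w : nat -> Z2) m (z : Z2) :=
  forall i, (i <= m)%N -> (w i).1 = z.1 -> z.2 < (w i).2.

Lemma kingC (u v : Z2) : king u v = king v u.
Proof. by rewrite /king; apply/idP/idP => /and4P[-> -> -> ->]. Qed.

Lemma nnC (u v : Z2) : nn u v -> nn v u.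
Proof. by move=> [k o]; split; [rewrite kingC | case: o => ->; [left|right]]. Qed.

Lemma nnpath_kpath w m : nnpath w m -> kpath w m.
Proof. by move=> nw i /nw[]. Qed.

Lemma king_flip (u v : Z2) : king (u.1, - u.2) (v.1, - v.2) = king u v.
Proof. by rewrite /king /=; lia. Qed.

(** Between the times [i] and [k] the path stays in one column by [fibered], so its height moves by
    at most 1 and cannot skip that of [z]. *)
Lemma kpath_hit w m z i k : kpath w m -> fibered w m ->
  (i <= m)%N -> (k <= m)%N -> (w i).1 = z.1 -> (w k).1 = z.1 ->
  (w i).2 <= z.2 <= (w k).2 -> on w m z.
Proof.
move=> kw fw im km ci ck zik; have [ik|ki] := leqP i k.
  have [||j jik jz] := @int_ivt (fun j => (w j).2) i k z.2 ik; [|lia|].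
    by move=> j jik; have := kw j; rewrite /king; lia.
  exists j; first lia.
  by apply: Z2_eq => //; rewrite (fw i j k) ?ci ?ck.
have [||j jik jz] := @int_ivt (fun j => - (w j).2) k i (- z.2) (ltnW ki); [|lia|].
  by move=> j jik; have := kw j; rewrite /king; lia.
exists j; first lia.
have jz' : (w j).2 = z.2 by lia.
by apply: Z2_eq => //; rewrite (fw k j i) ?ci ?ck.
Qed.

Lemma side_cases w m z : kpath w m -> fibered w m -> ~ on w m z ->
  above w m z \/ below w m z.
Proof.
move=> kw fw nz; case: (pselect (above w m z)) => [|na]; first by left.
right=> k km ck; rewrite ltNge; apply/negP => kz; apply: na => i im ci.
by rewrite ltNge; apply/negP => zi; apply: nz; apply: (kpath_hit kw fw km im ck ci); rewrite kz zi.
Qed.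

Lemma int_jump (f : nat -> int) (a b : nat) (t : int) : (a <= b)%N ->
  f a <= t < f b -> exists2 i, (a <= i < b)%N & f i <= t < f i.+1.
Proof.
elim: b => [|b IH] ab /andP[ta tb].
  have E : a = 0%N by [lia].
  by move: (le_lt_trans ta tb); rewrite E ltxx.
have [E|ltab] := eqVneq a b.+1.
  by move: (le_lt_trans ta tb); rewrite E ltxx.
have [tb'|tb'] := ltP t (f b); last by exists b; lia.
have [||i ib fi] := IH; [lia|lia|].
by exists i => //; lia.
Qed.

Lemma visits_step w m c : kpath w m -> visits w m c -> visits w m (c + 1) ->
  exists i j, [/\ (i <= m)%N, (j <= m)%N, king (w i) (w j),
    (w i).1 = c & (w j).1 = c + 1].
Proof.
move=> kw [i im ci] [j jm cj].
have [ij|ji] := leqP i j.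
  have [|k kij kc] := @int_jump (fun k => (w k).1) i j c ij; first lia.
  by exists k, k.+1; have := kw k; rewrite /king => H; split; lia.
have [|k kij kc] := @int_jump (fun k => - (w k).1) j i (- (c + 1)) (ltnW ji); first lia.
by exists k.+1, k; have := kw k; rewrite /king => H; split; lia.
Qed.

(** Otherwise, in one column a point of [w] would lie strictly between two adjacent vertices. In
    neighbouring columns [z] and [z'] have the same height, and some step of [w] would have to rise
    from under it to over it, by at least 2. *)
Lemma above_step w m z z' : kpath w m -> fibered w m ->
  visits w m z.1 -> visits w m z'.1 -> nn z z' -> above w m z ->
  ~ on w m z' -> above w m z'.
Proof.
move=> kw fw mz mz' [kz ez] az nz'.
have [//|bz] := side_cases kw fw nz'.
exfalso; have [c1|c1] := eqVneq z.1 z'.1.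
  have [i im ci] := mz; have := az i im ci; have := bz i im.
  by rewrite ci c1 => /(_ erefl); move: kz; rewrite /king; lia.
have ez2 : z.2 = z'.2 by case: ez => // E; rewrite E eqxx in c1.
have [i [j [im jm kij ci cj]]] : exists i j, [/\ (i <= m)%N, (j <= m)%N,
    king (w i) (w j), (w i).1 = z.1 & (w j).1 = z'.1].
  have [E|E] : z'.1 = z.1 + 1 \/ z.1 = z'.1 + 1 by move: kz; rewrite /king; lia.
    by rewrite E; apply: visits_step => //; rewrite -E.
  have [|i [j [im jm kij ci cj]]] := @visits_step w m z'.1 kw mz'; first by rewrite -E.
  by exists j, i; rewrite kingC; split=> //; rewrite E.
by have := az i im ci; have := bz j jm cj; move: kij; rewrite /king; lia.
Qed.

Definition flip (v : Z2) : Z2 := (v.1, - v.2).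
(* Left and right of a row-monotone path are below and above after swap. *)
Definition swap (v : Z2) : Z2 := (v.2, v.1).

Lemma below_step w m z z' : kpath w m -> fibered w m ->
  visits w m z.1 -> visits w m z'.1 -> nn z z' -> below w m z ->
  ~ on w m z' -> below w m z'.
Proof.
move=> kw fw mz mz' [kz ez] bz nz'.
have : above (flip \o w) m (flip z').
  apply: (@above_step (flip \o w) m (flip z)) => //.
  - by move=> i im; rewrite /= king_flip kw.
  - by split; [rewrite king_flip | case: ez => E; [left|right]; rewrite /= E].
  - by move=> i im ci; rewrite /= ltrN2; apply: bz.
  - case=> i im [c1 c2]; apply: nz'; exists i => //.
    by move/oppr_inj: c2; move: c1; case: (w i) => a b /= -> ->; case: (z').
by move=> H i im ci; have := H i im ci; rewrite /= ltrN2.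
Qed.

Lemma crossing w m (u : nat -> Z2) k : kpath w m -> fibered w m -> nnpath u k ->
  (forall i, (i <= k)%N -> visits w m (u i).1) ->
  below w m (u 0%N) -> above w m (u k) -> exists2 i, (i <= k)%N & on w m (u i).
Proof.
move=> kw fw nu mu b0 ak; apply: contrapT => no.
suff bk : below w m (u k).
  by have [i im ci] := mu k (leqnn k); have := ak i im ci; have := bk i im ci; lia.
have H i : (i <= k)%N -> below w m (u i).
  elim: i => [//|i IH] ik; apply: (below_step kw fw (mu i _) (mu i.+1 _) (nu i _)); try lia.
    by apply: IH; lia.
  by move=> oi; apply: no; exists i.+1.
exact: H.
Qed.

Lemma king_swap (u v : Z2) : king (swap u) (swap v) = king u v.
Proof. by rewrite /king /=; lia. Qed.

Lemma nn_swap (u v : Z2) : nn u v -> nn (swap u) (swap v).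
Proof. by move=> [k o]; split; [rewrite king_swap | case: o => E; [right|left]]. Qed.

Lemma on_swap w m z : on (swap \o w) m (swap z) -> on w m z.
Proof.
by case=> i im [c2 c1]; exists i => //; apply: Z2_eq.
Qed.

Lemma visits_between w m c : kpath w m -> (w 0%N).1 <= c <= (w m).1 ->
  visits w m c.
Proof.
move=> kw H; have [||i im ci] := @int_ivt (fun k => (w k).1) 0 m c (leq0n m); [|lia|by exists i].
by move=> i im; have := kw i; rewrite /king; lia.
Qed.

Lemma visits_between_rev w m c : kpath w m -> (w m).1 <= c <= (w 0%N).1 ->
  visits w m c.
Proof.
move=> kw H; have [||i im ci] := @int_ivt (fun k => - (w k).1) 0 m (- c) (leq0n m); [|lia|by exists i; lia].
by move=> i im; have := kw i; rewrite /king; lia.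
Qed.

(** * Circuits formed by three monotone curves *)

Section Circuit.
Variables (conn : Z2 -> Z2 -> Prop).
Hypothesis conn_refl : forall x, conn x x.
Hypothesis conn_trans : forall x y z, conn x y -> conn y z -> conn x z.

Definition cpath (w : nat -> Z2) m := forall i, (i < m)%N -> conn (w i) (w i.+1).

Lemma cpath_conn w m i j : cpath w m -> (i <= j <= m)%N -> conn (w i) (w j).
Proof.
move=> cw; elim: j => [|j IH] ij; first by have -> : i = 0%N by [lia].
have [->//|ne] := eqVneq i j.+1.
by apply: conn_trans (cw j _); [apply: IH; lia | lia].
Qed.

Variables (e : Z2) (l r r1 r2 : int) (a b u : nat -> Z2) (ka kb ku : nat).

(* The curves a (westward, into e), b (eastward, out of e) and u (upward) of the
   header, over the columns l to r, with u confined to the columns r1 to r2. *)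
Record circuit : Prop := Circuit {
  circuit_a : [/\ nnpath a ka, cpath a ka & fibered a ka];
  circuit_b : [/\ nnpath b kb, cpath b kb & fibered b kb];
  circuit_u : [/\ nnpath u ku, cpath u ku & fibered (swap \o u) ku];
  circuit_ends : [/\ a ka = e, b 0%N = e & e.1 = l];
  circuit_right : (a 0%N).1 = r /\ (b kb).1 = r;
  circuit_cols : l < r1 /\ r2 < r;
  circuit_ucols : forall i, (i <= ku)%N -> r1 <= (u i).1 <= r2;
  circuit_arows : forall i, (i <= ka)%N -> (u 0%N).2 < (a i).2 < (u ku).2;
  circuit_brows : forall i, (i <= kb)%N -> (u 0%N).2 < (b i).2 < (u ku).2;
  circuit_apos : forall i, (i <= ka)%N -> r1 <= (a i).1 -> 0 < (a i).2;
  circuit_bneg : forall i, (i <= kb)%N -> (b i).2 < 0 }.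

Hypothesis C : circuit.

Let na : nnpath a ka. Proof. by case: (circuit_a C). Qed.
Let nb : nnpath b kb. Proof. by case: (circuit_b C). Qed.
Let nu : nnpath u ku. Proof. by case: (circuit_u C). Qed.
Let ca : cpath a ka. Proof. by case: (circuit_a C). Qed.
Let cb : cpath b kb. Proof. by case: (circuit_b C). Qed.
Let cu : cpath u ku. Proof. by case: (circuit_u C). Qed.
Let fa : fibered a ka. Proof. by case: (circuit_a C). Qed.
Let fb : fibered b kb. Proof. by case: (circuit_b C). Qed.
Let fu : fibered (swap \o u) ku. Proof. by case: (circuit_u C). Qed.
Let ae : a ka = e. Proof. by case: (circuit_ends C). Qed.
Let be : b 0%N = e. Proof. by case: (circuit_ends C). Qed.
Let el : e.1 = l. Proof. by case: (circuit_ends C). Qed.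
Let ar : (a 0%N).1 = r. Proof. by case: (circuit_right C). Qed.
Let br : (b kb).1 = r. Proof. by case: (circuit_right C). Qed.
Let lr1 : l < r1. Proof. by case: (circuit_cols C). Qed.
Let r2r : r2 < r. Proof. by case: (circuit_cols C). Qed.
Let uc := circuit_ucols C.
Let ah := circuit_arows C.
Let bh := circuit_brows C.
Let apos := circuit_apos C.
Let bneg := circuit_bneg C.

Let ka_ := nnpath_kpath na.
Let kb_ := nnpath_kpath nb.

Let ku_ : kpath (swap \o u) ku.
Proof. by move=> i im; rewrite king_swap; case: (nu im). Qed.

Lemma visits_a c : l <= c <= r -> visits a ka c.
Proof. by move=> H; apply: visits_between_rev => //; rewrite ae ar; lia. Qed.

Lemma visits_b c : l <= c <= r -> visits b kb c.
Proof. by move=> H; apply: visits_between => //; rewrite be br; lia. Qed.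

Let visits_u h : (u 0%N).2 < h < (u ku).2 -> visits (swap \o u) ku h.
Proof. by move=> H; apply: visits_between => //=; lia. Qed.

(** The path [u] starts lower than all of [b]. It stays under [b] until they meet; from then on [e]
    reaches it along [b] and [u]. *)
Lemma up_from_e i : (i <= ku)%N -> below b kb (u i) \/ conn e (u i).
Proof.
elim: i => [|i IH] ik; first by left=> j jk _; have := bh jk; lia.
have [bi|ei] := IH (ltnW ik); last by right; apply: conn_trans ei (cu ik).
case: (pselect (on b kb (u i.+1))) => [[j jk <-]|no].
  by right; rewrite -be; apply: (cpath_conn cb); lia.
left; apply: (below_step kb_ fb _ _ (nu ik)) => //; apply: visits_b.
  by have := uc (ltnW ik); lia.
by have := uc ik; lia.
Qed.

(** Mirror image of [up_from_e], read backwards from the top of [u], which is higher than all of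
    [a]. *)
Lemma up_to_e i : (i <= ku)%N -> above a ka (u i) \/ conn (u i) e.
Proof.
move=> ik; have -> : i = (ku - (ku - i))%N by lia.
have : (ku - i <= ku)%N by lia.
elim: (ku - i)%N => [|j IH] jk.
  by left=> k kk _; rewrite subn0; have := ah kk; lia.
have E : ((ku - j.+1).+1 = ku - j)%N by lia.
have lt : (ku - j.+1 < ku)%N by lia.
have [ai|ei] := IH (ltnW jk); last by right; apply: conn_trans (cu lt) _; rewrite E.
case: (pselect (on a ka (u (ku - j.+1)%N))) => [[k kk <-]|no].
  by right; rewrite -ae; apply: (cpath_conn ca); lia.
left; have := nnC (nu lt); rewrite E => nuu; apply: (above_step ka_ fa _ _ nuu) => //; apply: visits_a.
  by have := @uc (ku - j)%N; lia.
by have := uc (ltnW lt); lia.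
Qed.

(** As [b] runs at negative heights, a point of [u] at positive height cannot be under it. *)
Lemma on_u_above_b i z : (i <= ku)%N -> u i = z -> 0 < z.2 -> conn e z.
Proof.
move=> ik uz z0; have [bi|] := up_from_e ik; last by rewrite uz.
have [|j jk cj] := visits_b (c := z.1); first by have := uc ik; rewrite uz; lia.
by have := bi j jk; rewrite uz => /(_ cj); have := bneg jk; lia.
Qed.

Lemma on_u_below_a i z : (i <= ku)%N -> u i = z -> z.2 < 0 -> conn z e.
Proof.
move=> ik uz z0; have [ai|] := up_to_e ik; last by rewrite uz.
have H := uc ik; rewrite uz in H.
have [|j jk cj] := visits_a (c := z.1); first by lia.
have := ai j jk; rewrite uz => /(_ cj); have := apos jk; lia.
Qed.

Lemma a_to_e i : (i <= ka)%N -> conn (a i) e.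
Proof. by move=> ik; rewrite -ae; apply: (cpath_conn ca); lia. Qed.

Lemma b_from_e i : (i <= kb)%N -> conn e (b i).
Proof. by move=> ik; rewrite -be; apply: (cpath_conn cb); lia. Qed.

(* The part of a on the right of u is the only one that e may fail to reach. *)
Lemma a_from_e i : (i <= ka)%N ->
  above (swap \o u) ku (swap (a i)) \/ conn e (a i).
Proof.
elim: i => [|i IH] ik; first by left=> j jk _ /=; have := uc jk; lia.
have [ai|ei] := IH (ltnW ik); last by right; apply: conn_trans ei (ca ik).
case: (pselect (on u ku (a i.+1))) => [[j jk uj]|no].
  right; apply: (on_u_above_b jk uj); apply: apos => //.
  by have := uc jk; rewrite uj; lia.
left; apply: (above_step ku_ fu _ _ (nn_swap (na ik))) => //.
- by apply: visits_u; apply: ah; lia.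
- by apply: visits_u; apply: ah.
- by move/on_swap.
Qed.

(** Traced backwards from its right end, [b] stays to the right of [u] until they meet. This happens
    at negative height, from where [u] leads on to [a] and [e]. *)
Lemma b_to_e i : (i <= kb)%N ->
  above (swap \o u) ku (swap (b i)) \/ conn (b i) e.
Proof.
move=> ik; have -> : i = (kb - (kb - i))%N by lia.
have : (kb - i <= kb)%N by lia.
elim: (kb - i)%N => [|j IH] jk.
  by left=> k kk _ /=; rewrite subn0 br; have := uc kk; lia.
have E : ((kb - j.+1).+1 = kb - j)%N by lia.
have lt : (kb - j.+1 < kb)%N by lia.
have [bi|ei] := IH (ltnW jk); last by right; apply: conn_trans (cb lt) _; rewrite E.
case: (pselect (on u ku (b (kb - j.+1)%N))) => [[k kk uk]|no].
  by right; apply: (on_u_below_a kk uk); apply: bneg; lia.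
left; have := nnC (nb lt); rewrite E => nbb; apply: (above_step ku_ fu _ _ (nn_swap nbb)) => //.
- by apply: visits_u; apply: bh; lia.
- by apply: visits_u; apply: bh; lia.
- by move/on_swap.
Qed.

(** Describing the wedge by sides of monotone curves takes the place of a Jordan curve argument. *)
Definition inside z := [/\ l <= z.1 <= r, above b kb z, below a ka z &
  below (swap \o u) ku (swap z)].

Lemma inside_bounds z : inside z -> (u 0%N).2 < z.2 < (u ku).2 /\ l < z.1 <= r2.
Proof.
move=> [cz az bz uz].
have [i ik ci] := visits_a cz; have [j jk cj] := visits_b cz.
have h : (u 0%N).2 < z.2 < (u ku).2.
  by have := ah ik; have := bh jk; have := az j jk cj; have := bz i ik ci; lia.
split=> //; apply/andP; split.
  (* In column [l] both curves pass through [e], so no point is strictly between them. *)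
  rewrite lt_neqAle; apply/andP; split; last by lia.
  apply/eqP => zl; have := az 0%N; have := bz ka (leqnn _).
  by rewrite ae be el => /(_ zl) + /(_ _ zl); lia.
have [k kk /= ck] := visits_u h.
by have := uz k kk ck; have := uc kk; rewrite /=; lia.
Qed.

(** A nearest-neighbour step can leave the wedge only by landing on one of the three curves, and the
    pieces that it can hit are mutually connected to [e]. *)
Lemma inside_step z z' : inside z -> nn z z' -> ~ (conn e z' /\ conn z' e) ->
  inside z'.
Proof.
move=> Iz nz nM; have [hz lz] := inside_bounds Iz; have [cz az bz uz] := Iz.
have [kz _] := nz.
have cz' : l <= z'.1 <= r by move: kz; rewrite /king; lia.
have hz' : (u 0%N).2 < z'.2 < (u ku).2.
  (have [i ik ci] := visits_a cz; have [j jk cj] := visits_b cz).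
  by have := ah ik; have := bh jk; have := az j jk cj; have := bz i ik ci; move: kz; rewrite /king; lia.
have uz' : ~ above (swap \o u) ku (swap z').
  case: (pselect (on (swap \o u) ku (swap z'))) => [[k kk ck]|no] H.
    have [c1 c2] := ck.
    by have := H k kk; rewrite /= c1 c2 => /(_ erefl); lia.
  have [k kk /= ck] := visits_u hz'.
  have := below_step (z := swap z) (z' := swap z') ku_ fu (visits_u hz) (visits_u hz') (nn_swap nz) uz no kk ck.
  by have := H k kk ck; rewrite /=; lia.
(* Since [z'] is not to the right of [u], [a_from_e] leaves only the connection from [e]. *)
have na' : ~ on a ka z'.
  case=> i ik ai; apply: nM; rewrite -ai; split.
    by have [|//] := a_from_e ik; rewrite ai.
  by rewrite -ae; apply: (cpath_conn ca); lia.
have nb' : ~ on b kb z'.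
  case=> i ik bi; apply: nM; rewrite -bi; split; last by have [|//] := b_to_e ik; rewrite bi.
  by rewrite -be; apply: (cpath_conn cb); lia.
have az' := above_step kb_ fb (visits_b cz) (visits_b cz') nz az nb'.
have bz' := below_step ka_ fa (visits_a cz) (visits_a cz') nz bz na'.
split=> //; apply: (below_step (z := swap z) (z' := swap z') ku_ fu (visits_u hz) (visits_u hz') (nn_swap nz) uz).
(* A point over [b] and under [a] excludes the first alternatives of [up_from_e] and [up_to_e]. *)
move/on_swap => -[i ik ui]; apply: nM; rewrite -ui; split.
  have [bi|//] := up_from_e ik.
  have [j jk cj] := visits_b cz'.
  by have := bi j jk; have := az' j jk cj; rewrite ui => ? /(_ cj); lia.
have [ai|//] := up_to_e ik.
have [j jk cj] := visits_a cz'.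
by have := ai j jk; have := bz' j jk cj; rewrite ui => ? /(_ cj); lia.
Qed.

End Circuit.

(** * Walks *)

Definition holds (w : Z2 -> bool) (L : seq (Z2 * bool)) : bool :=
  all (fun x => w x.1 == x.2) L.

Definition upcol (c h : int) (j : nat) : seq (Z2 * bool) :=
  [seq ((c, h + Posz i), true) | i <- iota 0 j] ++ [:: ((c, h + Posz j), false)].
Definition downcol (c h : int) (j : nat) : seq (Z2 * bool) :=
  [seq ((c, h - Posz i), false) | i <- iota 0 j.+1] ++ [:: ((c, h - Posz j.+1), true)].

(* Cylinder events that cover the event that the walk of k columns from (c, h) in
   direction s, with increments at most n, ends at height h0 or above. *)
Fixpoint climbs (s : int) (n k : nat) (c h h0 : int) : seq (seq (Z2 * bool)) :=
  if k is k'.+1 then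
    flatten [seq [seq upcol c h j ++ L | L <- climbs s n k' (c + s) (h + Posz j) h0]
            | j <- iota 1 n] ++
    flatten [seq [seq downcol c h j ++ L | L <- climbs s n k' (c + s) (h - Posz j) h0]
            | j <- iota 0 n.+1]
  else if h0 <= h then [:: [::]] else [::].

Lemma climbsS s n k c h h0 : climbs s n k.+1 c h h0 =
  flatten [seq [seq upcol c h j ++ L | L <- climbs s n k (c + s) (h + Posz j) h0]
          | j <- iota 1 n] ++
  flatten [seq [seq downcol c h j ++ L | L <- climbs s n k (c + s) (h - Posz j) h0]
          | j <- iota 0 n.+1].
Proof. by []. Qed.

Definition vrun (b : bool) (n : nat) (v : Z2) : seq (Z2 * bool) :=
  [seq ((v.1, v.2 + Posz i), b) | i <- iota 0 n].
Definition hrun (n : nat) (v : Z2) : seq (Z2 * bool) :=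
  [seq ((v.1 + Posz i, v.2), false) | i <- iota 0 n].

Definition zrange (X : nat) : seq int := [seq Posz i - Posz X | i <- iota 0 (2 * X).+1].

(** A finite list of cylinder events, so that a union bound controls the failure of [good]. *)
Definition traps (n X : nat) : seq (seq (Z2 * bool)) :=
  flatten [seq [:: vrun true n v; vrun false n v; hrun n v] ++
    climbs 1 n n v.1 v.2 v.2 ++ climbs (-1) n n v.1 v.2 v.2
    | v <- [seq (c, h) | c <- zrange X, h <- zrange X]].

Definition good (w : Z2 -> bool) (n X : nat) : bool := ~~ has (holds w) (traps n X).

Lemma zrangeP (X : nat) (c : int) : - Posz X <= c <= Posz X -> c \in zrange X.
Proof.
move=> H; apply/mapP; exists (absz (c + Posz X)); last by lia.
by rewrite mem_iota; lia.
Qed.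

Definition inbox (X : nat) (v : Z2) : bool :=
  (- Posz X <= v.1 <= Posz X) && (- Posz X <= v.2 <= Posz X).

Lemma good_trap w n X v L : good w n X -> inbox X v ->
  L \in [:: vrun true n v; vrun false n v; hrun n v] ++
    climbs 1 n n v.1 v.2 v.2 ++ climbs (-1) n n v.1 v.2 v.2 -> ~~ holds w L.
Proof.
move=> /hasPn gw /andP[v1 v2] Lin; apply: gw; apply/flattenP; eexists; last exact: Lin.
apply/mapP; exists v => //; apply/allpairsP; exists (v.1, v.2); split => //=.
- exact: zrangeP.
- exact: zrangeP.
- by case: (v).
Qed.

(* Looking one vertex down makes the walk memoryless: after ascending an up run
   it stands above an up vertex, so it moves sideways instead of turning back. *)
Definition step (w : Z2 -> bool) (s : int) (v : Z2) : Z2 :=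
  if w v then (v.1, v.2 + 1)
  else if w (v.1, v.2 - 1) then (v.1 + s, v.2) else (v.1, v.2 - 1).

Section Walk.
Variables (w : Z2 -> bool) (s : int).
Hypothesis hs : s = 1 \/ s = -1.

Lemma step_nn v : nn v (step w s v).
Proof.
rewrite /step /nn /king; case: (w v) => /=; first by split; [lia|left].
case: (w _) => /=; split; [by case: hs => ->; lia|by right|lia|by left].
Qed.

Lemma step_col v : 0 <= s * ((step w s v).1 - v.1).
Proof.
rewrite /step; case: hs => ->; (case: (w v) => /=; last case: (w _) => /=); lia.
Qed.

Definition walk v (i : nat) := iter i (step w s) v.

Lemma walk_nn v m : nnpath (walk v) m.
Proof. by move=> i _; apply: step_nn. Qed.

Lemma walk_col v i j : (i <= j)%N -> 0 <= s * ((walk v j).1 - (walk v i).1).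
Proof.
elim: j => [|j IH] ij; first by have -> : i = 0%N by [lia]; lia.
have [->|ne] := eqVneq i j.+1; first by lia.
have := IH ltac:(lia); have := step_col (walk v j); rewrite -[step w s _]/(walk v j.+1).
by case: hs => ->; lia.
Qed.

Lemma walk_fibered v m : fibered (walk v) m.
Proof.
move=> i j k /andP[ij jk] _ E; have := walk_col v ij; have := walk_col v jk.
by case: hs => ->; lia.
Qed.

Lemma walk_add v i j : walk v (i + j) = walk (walk v j) i.
Proof. by rewrite /walk iterD. Qed.

Lemma vrunN b n v : ~~ holds w (vrun b n v) ->
  exists2 i, (i < n)%N & w (v.1, v.2 + Posz i) = ~~ b.
Proof.
move=> /allPn[x /mapP[i]]; rewrite mem_iota => ib -> /= wb.
by exists i; [lia | move: wb; case: (w _); case: (b)].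
Qed.

(** From an up vertex the walk climbs to the end of the up run; otherwise it descends until the
    vertex underneath is up. Either way it stands over an up vertex and must move sideways, and the
    lack of runs of length [n] bounds the height change. *)
Lemma walk_column n c h : (forall b h', h - Posz n <= h' <= h ->
    ~~ holds w (vrun b n (c, h'))) ->
  exists m (d : int),
    [/\ walk (c, h) m = (c + s, h + d),
        forall i, (i <= m)%N -> 0 <= s * ((walk (c, h) i).1 - c) <= 1 /\
           - Posz n <= (walk (c, h) i).2 - h <= Posz n,
        - Posz n <= d <= Posz n &
        (exists j, [/\ d = Posz j, (0 < j)%N & holds w (upcol c h j)]) \/
        (exists j, [/\ d = - Posz j & holds w (downcol c h j)])].
Proof.
move=> nr; case Uv : (w (c, h)).
  have [|i0 i0n /= wi0] := vrunN (nr true h _); first lia.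
  have ex : exists i, ~~ w (c, h + Posz i) by exists i0; rewrite wi0.
  have [j wj jmin] := ex_minnP ex.
  have jn : (j <= i0)%N by apply: jmin; rewrite wi0.
  have j0 : (0 < j)%N by case: (j) wj => //; rewrite addr0 Uv.
  have lo i : (i < j)%N -> w (c, h + Posz i).
    by move=> ij; apply: contraT => /jmin; lia.
  have W i : (i <= j)%N -> walk (c, h) i = (c, h + Posz i).
    elim: i => [|i IH] ij; first by rewrite /walk /= addr0.
    rewrite /walk iterS -/(walk (c, h) i) IH ?(ltnW ij) // /step lo //=.
    by congr pair; lia.
  have Wl : walk (c, h) j.+1 = (c + s, h + Posz j).
    rewrite /walk iterS -/(walk (c, h) j) W // /step (negbTE wj) /=.
    have -> : h + Posz j - 1 = h + Posz j.-1 by lia.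
    by rewrite lo //; lia.
  exists j.+1, (Posz j); split=> //; [|lia|left].
    move=> i; rewrite leq_eqVlt => /orP[/eqP->|ij]; first by rewrite Wl /=; case: hs => ->; lia.
    by rewrite W //=; case: hs => ->; lia.
  exists j; split=> //; rewrite /holds all_cat /= (negbTE wj) eqxx !andbT.
  by apply/allP => x /mapP[i]; rewrite mem_iota => ij -> /=; rewrite lo.
(* As [vrun] extends upwards, a run of n vertices with top at height h starts at h - (n - 1). *)
have [|i0 i0n /= wi0] := vrunN (nr false (h - Posz n.-1) _); first lia.
have E0 : w (c, h - Posz (n.-1 - i0)).
  by have -> : h - Posz (n.-1 - i0) = h - Posz n.-1 + Posz i0 by lia; rewrite wi0.
have ex : exists i, w (c, h - Posz i).
  by exists (n.-1 - i0)%N; rewrite E0.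
have [j wj jmin] := ex_minnP ex.
have jn : (j <= n.-1 - i0)%N by apply: jmin; rewrite E0.
case: j wj jmin jn => [|j] wj jmin jn; first by rewrite subr0 Uv in wj.
have lo i : (i <= j)%N -> w (c, h - Posz i) = false.
  by move=> ij; apply: contraTF isT => /jmin; lia.
have W i : (i <= j)%N -> walk (c, h) i = (c, h - Posz i).
  elim: i => [|i IH] ij; first by rewrite /walk /= subr0.
  rewrite /walk iterS -/(walk (c, h) i) IH ?(ltnW ij) // /step lo ?(ltnW ij) //=.
  have -> : h - Posz i - 1 = h - Posz i.+1 by lia.
  by rewrite lo.
have Wl : walk (c, h) j.+1 = (c + s, h - Posz j).
  rewrite /walk iterS -/(walk (c, h) j) W // /step lo //=.
  have -> : h - Posz j - 1 = h - Posz j.+1 by lia.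
  by rewrite wj.
exists j.+1, (- Posz j); split=> //; [|lia|right].
  move=> i; rewrite leq_eqVlt => /orP[/eqP->|ij]; first by rewrite Wl /=; case: hs => ->; lia.
  by rewrite W //=; case: hs => ->; lia.
exists j; split=> //; rewrite /holds all_cat /= wj eqxx !andbT -/(iota 0 j.+1).
rewrite subr0 Uv eqxx /=.
by apply/allP => x /mapP[i]; rewrite mem_iota => ij -> /=; rewrite lo //; lia.
Qed.

Lemma walk_columns n k c h h0 :
  (forall b c' h', 0 <= s * (c' - c) < Posz k ->
     - Posz (n * k) <= h' - h <= Posz (n * k) -> ~~ holds w (vrun b n (c', h'))) ->
  exists m h',
    [/\ walk (c, h) m = (c + s * Posz k, h'),
        forall i, (i <= m)%N -> 0 <= s * ((walk (c, h) i).1 - c) <= Posz k /\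
           - Posz (n * k) <= (walk (c, h) i).2 - h <= Posz (n * k) &
        h0 <= h' -> has (holds w) (climbs s n k c h h0)].
Proof.
elim: k c h => [|k IH] c h nr.
  exists 0%N, h; split; first by rewrite /walk /= mulr0 addr0.
    by move=> i; rewrite leqn0 => /eqP ->; rewrite /walk /= muln0; lia.
  by move=> h0h; rewrite /climbs h0h.
have [|m1 [d [W1 P1 dn E1]]] := @walk_column n c h.
  by move=> b h' hh; apply: nr; [case: hs => -> | ]; rewrite ?mulnS; lia.
have [|m2 [h' [W2 P2 E2]]] := IH (c + s) (h + d).
  move=> b c' h' c1 h1; apply: nr; last by rewrite mulnS; lia.
  by move: c1; case: hs => ->; lia.
exists (m2 + m1)%N, h'; split.
- by rewrite walk_add W1 W2; congr pair; case: hs => ->; lia.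
- move=> i im; have [im1|im1] := leqP i m1.
    by have := P1 i im1; rewrite mulnS; case: hs => ->; lia.
  have -> : i = ((i - m1) + m1)%N by lia.
  rewrite walk_add W1; have := P2 (i - m1)%N ltac:(lia); set z := walk _ _ => H.
  rewrite mulnS; move: (z) H. by case: hs => ->; lia.
- move=> /E2 /hasP[L Lin Lh]; apply/hasP.
  case: E1 => [[j [dj j0 hj]]|[j [dj hj]]].
    exists (upcol c h j ++ L); last by rewrite /holds all_cat; apply/andP.
    rewrite climbsS mem_cat; apply/orP; left; apply/flattenP; eexists.
      by apply/mapP; exists j => //; rewrite mem_iota; lia.
    by apply/mapP; exists L => //; rewrite -dj.
  exists (downcol c h j ++ L); last by rewrite /holds all_cat; apply/andP.
  rewrite climbsS mem_cat; apply/orP; right; apply/flattenP; eexists.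
    by apply/mapP; exists j => //; rewrite mem_iota; lia.
  by apply/mapP; exists L => //; rewrite -dj.
Qed.

Lemma walk_block n X c h : good w n X ->
  - Posz X <= c <= Posz X -> - Posz X <= c + s * Posz n <= Posz X ->
  Posz (n * n) <= Posz X - h -> Posz (n * n) <= Posz X + h ->
  exists m h',
    [/\ walk (c, h) m = (c + s * Posz n, h'), h' < h &
        forall i, (i <= m)%N -> 0 <= s * ((walk (c, h) i).1 - c) <= Posz n /\
           - Posz (n * n) <= (walk (c, h) i).2 - h <= Posz (n * n)].
Proof.
move=> g c1 c2 h1 h2; have [|m [h' [W P E]]] := @walk_columns n n c h h.
  move=> b c' h' cc hh; apply: (good_trap (v := (c', h')) g).
    by rewrite /inbox /=; move: cc c2; case: hs => ->; lia.
  by rewrite !inE mem_cat; case: b; rewrite eqxx ?orbT.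
exists m, h'; split=> //; rewrite ltNge; apply/negP => /E /hasP[L Lin].
apply/negP; apply: (good_trap (v := (c, h)) g); first by rewrite /inbox /=; lia.
by rewrite !inE !mem_cat /=; move: Lin; case: hs => -> ->; rewrite ?orbT.
Qed.

(** Each block of n columns loses between 1 and n^2 in height. The extra [Posz n] in the last bound
    pays for the unfinished block. *)
Lemma walk_blocks n X J c h : good w n X ->
  - Posz X <= c <= Posz X -> - Posz X <= c + s * Posz (n * J) <= Posz X ->
  Posz (n * n) <= Posz X - h -> Posz (n * (n * J)) <= Posz X + h ->
  exists m h',
    [/\ walk (c, h) m = (c + s * Posz (n * J), h'),
        h - Posz (n * (n * J)) <= h' <= h - Posz J &
        forall i, (i <= m)%N -> [/\ 0 <= s * ((walk (c, h) i).1 - c) <= Posz (n * J),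
          (walk (c, h) i).2 <= h + Posz (n * n) &
          h - Posz n * (s * ((walk (c, h) i).1 - c) + Posz n) <= (walk (c, h) i).2]].
Proof.
move=> g c1; elim: J => [|J IH] c2 h1 h2.
  exists 0%N, h; split; [by rewrite /walk /= !muln0 mulr0 addr0|lia|].
  by move=> i; rewrite leqn0 => /eqP ->; rewrite /walk /= !muln0 subrr mulr0; split; nia.
have [|||m1 [h' [W1 hh P1]]] := IH; [|by []|by rewrite !(mulnS, mulnDr) in h2 *; lia|].
  by move: c2; rewrite mulnS; case: hs => ->; lia.
have [||||m2 [h'' [W2 hh2 P2]]] := @walk_block n X (c + s * Posz (n * J)) h' g.
- by move: c2; rewrite mulnS; case: hs => ->; lia.
- by move: c2; rewrite mulnS; case: hs => ->; lia.
- by lia.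
- by move: h2; rewrite !(mulnS, mulnDr); lia.
exists (m2 + m1)%N, h''; split.
- by rewrite walk_add W1 W2 mulnS; congr pair; case: hs => ->; lia.
- have [_ ] := P2 m2 (leqnn _); rewrite W2 /= !(mulnS, mulnDr); lia.
- move=> i im; have [im1|im1] := leqP i m1.
    by have [p1 p2 p3] := P1 i im1; split=> //; rewrite mulnS; lia.
  have -> : i = ((i - m1) + m1)%N by lia.
  rewrite walk_add W1; have [] := P2 (i - m1)%N ltac:(lia).
  set z := walk _ _; move: (z) => {z} z q1 q2; split.
  + by move: q1; rewrite mulnS; case: hs => ->; lia.
  + by lia.
  + have q3 : Posz (n * J) <= s * (z.1 - c) by move: q1; case: hs => ->; lia.
    by move: q3; move: (s * _) => t; nia.
Qed.

End Walk.

(** * Circuits at a given scale *)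

Lemma reaches_refl (E : Z2 -> Z2 -> Prop) x : reaches E x x.
Proof. by exists 0%N, (fun=> x). Qed.

Lemma reaches1 (E : Z2 -> Z2 -> Prop) x y : E x y -> reaches E x y.
Proof. by move=> Exy; exists 1%N, (fun i => if i is 0%N then x else y); split=> // -[]. Qed.

Lemma reaches_trans (E : Z2 -> Z2 -> Prop) x y t :
  reaches E x y -> reaches E y t -> reaches E x t.
Proof.
move=> [n [f [f0 fn fE]]] [m [g [g0 gm gE]]].
exists (n + m)%N, (fun i => if (i <= n)%N then f i else g (i - n)%N); split.
- by rewrite leq0n.
- case: ifP => [nm|_]; last by rewrite addKn.
  by have m0 : m = 0%N by [lia]; move: gm; rewrite m0 addn0 fn g0.
- move=> i ilt; have [le_in|lt_ni] := leqP i n; last first.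
    have -> : (i.+1 <= n)%N = false by lia.
    by rewrite subSn ?(ltnW lt_ni) //; apply: gE; lia.
  have [lt_in|ge_in] := ltnP i n; first exact: fE.
  have -> : i = n by lia.
  by rewrite subSnn fn -g0; apply: gE; lia.
Qed.

Definition env (w : Z2 -> bool) (x : Z2) : {set dir} :=
  if w x then dirset [:: e2] else dirset [:: - e1; e1; - e2].

Definition conn (w : Z2 -> bool) : Z2 -> Z2 -> Prop := reaches (Defs.arc (env w)).

Lemma arc_env w x y : y - x \in (if w x then [:: e2] else [:: - e1; e1; - e2]) ->
  Defs.arc (env w) x y.
Proof.
move=> yx; have yu : y - x \in units.
  by move: yx; rewrite /units !inE; case: ifP => _; rewrite !inE;
     [move=> /eqP-> | move=> /or3P[]/eqP->]; rewrite eqxx ?orbT.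
by exists (SeqSub yu) => //; move: yx; rewrite /env; case: ifP => _ ?; rewrite inE.
Qed.

Lemma arc_step w s v : s = 1 \/ s = -1 -> conn w v (step w s v).
Proof.
move=> hs; apply/reaches1/arc_env; rewrite /step; case: v => c h /=.
case: ifP => wv; first by rewrite !inE /=; apply/eqP; congr pair; rewrite /=; lia.
case: ifP => _; rewrite !inE.
  have -> : (c + s, h) - (c, h) = (s, 0) :> Z2 by congr pair; rewrite /=; lia.
  by case: hs => ->; rewrite /e1 ?eqxx ?orbT.
by apply/orP; right; apply/orP; right; apply/eqP; congr pair; rewrite /=; lia.
Qed.

Lemma walk_cpath w s v m : s = 1 \/ s = -1 -> cpath (conn w) (walk w s v) m.
Proof. by move=> hs i _; apply: arc_step. Qed.

(** * The ascending path in a strip of columns *)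

Section Ascent.
Variables (w : Z2 -> bool) (t : int -> int) (R N H : int).
Hypothesis tP : forall h, - H <= h <= H -> R <= t h <= R + N /\ w (t h, h).

Definition ustep v : Z2 :=
  if w v then (v.1, v.2 + 1) else if v.1 < t v.2 then (v.1 + 1, v.2) else (v.1 - 1, v.2).

Definition uwalk v i := iter i ustep v.

Lemma ustep_nn v : nn v (ustep v).
Proof.
rewrite /ustep /nn /king; case: (w v) => /=; first by split; [lia|left].
by case: (v.1 < _) => /=; split; [lia|right|lia|right].
Qed.

Lemma arc_ustep v : conn w v (ustep v).
Proof.
apply/reaches1/arc_env; rewrite /ustep; case: v => c h /=.
case: ifP => wv; first by rewrite !inE /=; apply/eqP; congr pair; rewrite /=; lia.
case: ifP => _; rewrite !inE.
  by apply/orP; right; apply/orP; left; apply/eqP; congr pair; rewrite /=; lia.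
by apply/orP; left; apply/eqP; congr pair; rewrite /=; lia.
Qed.

Lemma uwalk_row v i j : (i <= j)%N -> (uwalk v i).2 <= (uwalk v j).2.
Proof.
elim: j => [|j IH] ij; first by have -> : i = 0%N by [lia].
have [->|ne] := eqVneq i j.+1; first by [].
apply: (le_trans (IH _)); first by lia.
rewrite /uwalk iterS -/(uwalk v j) /ustep; case: (w _) => /=; first by lia.
by case: (_ < _).
Qed.

Lemma uwalk_fibered v m : fibered (swap \o uwalk v) m.
Proof.
move=> i j k /andP[ij jk] _ /= E; have := uwalk_row v ij; have := uwalk_row v jk.
by lia.
Qed.

Lemma uwalk_add v i j : uwalk v (i + j) = uwalk (uwalk v j) i.
Proof. by rewrite /uwalk iterD. Qed.

Lemma uwalk_one_row (d : nat) v : - Posz d <= v.1 - t v.2 <= Posz d ->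
  R <= v.1 <= R + N -> - H <= v.2 <= H ->
  exists k c, [/\ uwalk v k = (c, v.2 + 1), R <= c <= R + N &
    forall i, (i <= k)%N -> R <= (uwalk v i).1 <= R + N].
Proof.
have up z : w z -> R <= z.1 <= R + N ->
  exists k c, [/\ uwalk z k = (c, z.2 + 1), R <= c <= R + N &
    forall i, (i <= k)%N -> R <= (uwalk z i).1 <= R + N].
  move=> wz zR; exists 1%N, z.1; split=> //; first by rewrite /uwalk /= /ustep wz.
  by case=> [|[|//]] _; rewrite /uwalk /= ?/ustep ?wz.
elim: d v => [|d IH] v dv vR vH; have [tR wt] := tP vH.
  by apply: up => //; case: v dv wt {vR vH tR} => c h /= ? ; have -> : c = t h by lia.
case wv : (w v); first exact: up.
have E : ustep v = (if v.1 < t v.2 then v.1 + 1 else v.1 - 1, v.2).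
  by rewrite /ustep wv; case: ifP.
have vt : v.1 != t v.2.
  by apply/eqP => vt; move: wt; rewrite -vt; move: wv; case: (v) => c h /= ->.
have [|||k [c [W cR P]]] := IH (ustep v).
- by rewrite E /=; case: ifP; lia.
- by rewrite E /=; case: ifP; lia.
- by rewrite E.
exists (k + 1)%N, c; split=> //; first by rewrite uwalk_add /= W E.
case=> [|i] ik; first by [].
by rewrite -addn1 uwalk_add; apply: P; lia.
Qed.

Lemma uwalk_rows (j : nat) v : R <= v.1 <= R + N -> - H <= v.2 -> v.2 + Posz j <= H + 1 ->
  exists k c, [/\ uwalk v k = (c, v.2 + Posz j), R <= c <= R + N &
    forall i, (i <= k)%N -> R <= (uwalk v i).1 <= R + N].
Proof.
move=> vR vH; elim: j => [|j IH] jH.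
  exists 0%N, v.1; split=> //; first by rewrite addr0 /uwalk; case: (v).
  by case.
have [|k [c [W cR P]]] := IH; first by lia.
have [|||k' [c' [W' cR' P']]] := @uwalk_one_row (absz (c - t (v.2 + Posz j))) (c, v.2 + Posz j).
- by rewrite /=; lia.
- by [].
- by rewrite /=; lia.
exists (k' + k)%N, c'; split=> //.
  by rewrite uwalk_add W W' /=; congr pair; lia.
move=> i ik; have [|ki] := leqP i k; first exact: P.
have -> : i = ((i - k) + k)%N by lia.
by rewrite uwalk_add W; apply: P'; lia.
Qed.

End Ascent.

(** At scale n + 1 the curves [a] and [b] have heights at most 16 (n + 1)^5 <= 512 n^5 in absolute
    value, so 600 n^5 is enough for [u] of scale n to cross them as well. *)
Definition scale_circuit w (n : nat) (e : Z2) a b u ka kb ku :=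
  [/\ circuit (conn w) e (Posz (n ^ 2) + Posz n + 1 - 8 * Posz (n ^ 4))
       (Posz (n ^ 2) + Posz n + 1) (Posz (n ^ 2)) (Posz (n ^ 2) + Posz n) a b u ka kb ku,
     forall i, (i <= ka)%N -> - 16 * Posz (n ^ 5) <= (a i).2 <= 16 * Posz (n ^ 5) /\
       (- Posz n <= (a i).1 -> Posz n < (a i).2),
     forall i, (i <= kb)%N -> - 16 * Posz (n ^ 5) <= (b i).2 < - Posz n &
     (u 0%N).2 = - 600 * Posz (n ^ 5) /\ (u ku).2 = 600 * Posz (n ^ 5)].

(* A starts at height 5 n^3 and loses at most n per column, so it is still above n
   at column -n; it loses at least 8 n^3 over its 8 n^4 columns, so B starts at
   height at most -3 n^3 and, rising at most n^2 within n columns, stays below -n. *)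
Lemma scale_circuit_exists w (n : nat) : (2 <= n)%N -> good w n (1000 * n ^ 5) ->
  exists e a b u ka kb ku, scale_circuit w n e a b u ka kb ku.
Proof.
move=> n2 g; rewrite /scale_circuit.
have s1 : (1 : int) = 1 \/ (1 : int) = -1 by left.
have sm1 : (-1 : int) = 1 \/ (-1 : int) = -1 by right.
have p2 : (n ^ 2 = n * n)%N by rewrite expnS expn1.
have p3 : (n ^ 3 = n * n ^ 2)%N by rewrite expnS.
have p4 : (n ^ 4 = n * n ^ 3)%N by rewrite expnS.
have p5 : (n ^ 5 = n * n ^ 4)%N by rewrite expnS.
have l2 : (2 * n <= n ^ 2)%N by rewrite p2 leq_mul2r n2 orbT.
have l3 : (2 * n ^ 2 <= n ^ 3)%N by rewrite p3 leq_mul2r n2 orbT.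
have l4 : (2 * n ^ 3 <= n ^ 4)%N by rewrite p4 leq_mul2r n2 orbT.
have l5 : (2 * n ^ 4 <= n ^ 5)%N by rewrite p5 leq_mul2r n2 orbT.
have j4 : (n * (8 * n ^ 3) = 8 * n ^ 4)%N by rewrite p4 mulnCA.
have j5 : (n * (8 * n ^ 4) = 8 * n ^ 5)%N by rewrite p5 mulnCA.
set m2 := (n ^ 2)%N in p2 p3 l2 l3 *; set m3 := (n ^ 3)%N in p3 p4 l3 l4 j4 *.
set m4 := (n ^ 4)%N in p4 p5 l4 l5 j4 j5 *; set m5 := (n ^ 5)%N in g p5 l5 j5 *.
clearbody m2 m3 m4 m5.
pose r : int := Posz m2 + Posz n + 1.
have [||||ka [h []]] := @walk_blocks w (-1) sm1 n (1000 * m5) (8 * m3) r (5 * Posz m3) g;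
  rewrite ?j4 ?j5 -?p2 /r; [lia|lia|lia|lia|].
set a := walk w (-1) _ => Wa ha Pa.
have [||||kb [h' []]] := @walk_blocks w 1 s1 n (1000 * m5) (8 * m3) (r - 8 * Posz m4) h g;
  rewrite ?j4 ?j5 -?p2 /r; [lia|lia|lia|lia|].
set b := walk w 1 _ => Wb hb Pb.
have arow i : (i <= ka)%N -> - 16 * Posz m5 <= (a i).2 <= 16 * Posz m5 /\
       (- Posz n <= (a i).1 -> Posz n < (a i).2).
  move=> ik; have [q1 q2 q3] := Pa i ik; split.
    have : Posz n * (-1 * ((a i).1 - r) + Posz n) <= Posz n * (Posz (8 * m4) + Posz n).
      by apply: ler_wpM2l => //; rewrite /r; lia.
    by move: q3; rewrite /r; nia.
  move=> an.
  have : Posz n * (-1 * ((a i).1 - r) + Posz n) <= Posz n * (Posz m2 + 3 * Posz n + 1).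
    by apply: ler_wpM2l => //; rewrite /r; lia.
  by move: q3; rewrite /r; nia.
have brow i : (i <= kb)%N -> - 16 * Posz m5 <= (b i).2 < - Posz n.
  move=> ik; have [q1 q2 q3] := Pb i ik.
  have : Posz n * (1 * ((b i).1 - (r - 8 * Posz m4)) + Posz n) <= Posz n * (Posz (8 * m4) + Posz n).
    by apply: ler_wpM2l => //; rewrite /r; lia.
  by move: q3; rewrite /r; nia.
(* Without horizontal runs of length n, each relevant row has an up vertex in the strip; the other
   rows get the default 0. *)
have /choice[t tP] : forall h : int, exists c : int, - (600 * Posz m5) <= h <= 600 * Posz m5 ->
    Posz m2 <= c <= Posz m2 + Posz n /\ w (c, h).
  move=> y; case: (pselect (- (600 * Posz m5) <= y <= 600 * Posz m5)) => [yH|]; last by exists 0.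
  have : ~~ holds w (hrun n (Posz m2, y)).
    apply: (good_trap (v := (Posz m2, y)) g); first by rewrite /inbox /=; lia.
    by rewrite !inE eqxx ?orbT.
  move=> /allPn[x /mapP[i]]; rewrite mem_iota => ib -> /= wb.
  by exists (Posz m2 + Posz i) => _; split; [lia | move: wb; case: (w _)].
have [|||ku [c' []]] := @uwalk_rows w t (Posz m2) (Posz n) (600 * Posz m5) tP
  (1200 * m5) (Posz m2, - (600 * Posz m5)); rewrite /=; [lia|lia|lia|].
set u := uwalk w t _ => Wu uc Pu.
have u0 : (u 0%N).2 = - 600 * Posz m5 by rewrite /u /uwalk /=; lia.
have uk : (u ku).2 = 600 * Posz m5 by rewrite Wu /=; lia.
exists (r - 8 * Posz m4, h), a, b, u, ka, kb, ku; split=> //; last first.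
split.
- by split; [apply: walk_nn | apply: walk_cpath | apply: walk_fibered].
- by split; [apply: walk_nn | apply: walk_cpath | apply: walk_fibered].
- split; [by move=> i _; apply: ustep_nn | by move=> i _; apply: arc_ustep |].
  exact: uwalk_fibered.
- by split=> //; rewrite Wa /r; congr pair; lia.
- by split=> //; rewrite Wb /r /=; lia.
- by split; lia.
- exact: Pu.
- by move=> i ik; have [] := arow i ik; rewrite u0 uk; lia.
- by move=> i ik; have := brow i ik; rewrite u0 uk; lia.
- by move=> i ik m2a; have [_] := arow i ik; lia.
- by move=> i ik; have := brow i ik; lia.
Qed.

(** * The gigantic component *)

Lemma conn_refl w x : conn w x x.
Proof. exact: reaches_refl. Qed.

Lemma conn_trans w x y z : conn w x y -> conn w y z -> conn w x z.
Proof. exact: reaches_trans. Qed.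

Lemma units_nn z z' : z' - z \in units -> nn z z'.
Proof.
case: z z' => [c h] [c' h']; rewrite /units !inE /nn /king /=.
move=> /or4P[] /eqP E; have := congr1 fst E; have := congr1 snd E; rewrite /= => E2 E1;
  (split; first lia); [right|right|left|left]; lia.
Qed.

Lemma finite_inbox (X : nat) : finite_set [set v | inbox X v].
Proof.
apply: (@sub_finite_set _ _ [set` [seq (c, h) | c <- zrange X, h <- zrange X]]).
  move=> v /andP[v1 v2]; apply/allpairsP; exists (v.1, v.2); split => //=.
  - exact: zrangeP.
  - exact: zrangeP.
  - by case: (v).
exact: finite_seq.
Qed.

(** The path [u] meets [a'] at positive height, where [e] reaches it and [a'] leads on to [e']. It
    meets [b'] at negative height, where [e'] reaches it and [u] leads on to [e]. *)
Lemma circuits_linked w (n : nat) e a b u ka kb ku e' a' b' u' ka' kb' ku' : (2 <= n)%N ->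
  scale_circuit w n e a b u ka kb ku -> scale_circuit w n.+1 e' a' b' u' ka' kb' ku' ->
  conn w e e' /\ conn w e' e.
Proof.
move=> n2 [C Ca Cb [u0 uk]] [C' Ca' Cb' _].
have l5 : (n.+1 ^ 5 <= 32 * n ^ 5)%N.
  by rewrite -[32%N]/(2 ^ 5)%N -expnMn leq_exp2r //; lia.
have l4 : (n.+1 <= n.+1 ^ 4)%N by rewrite -{1}[n.+1]expn1 leq_exp2l //; lia.
have l2 : (n.+1 ^ 2 = n ^ 2 + 2 * n + 1)%N by rewrite !expnS !expn0; nia.
have l4' : (n ^ 2 <= n.+1 ^ 4)%N by apply: (@leq_trans (n.+1 ^ 2)); [rewrite leq_exp2r | rewrite leq_exp2l //; lia].
have cols i : (i <= ku)%N -> Posz (n.+1 ^ 2) + Posz n.+1 + 1 - 8 * Posz (n.+1 ^ 4) <=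
   (u i).1 <= Posz (n.+1 ^ 2) + Posz n.+1 + 1.
  by move=> /(circuit_ucols C); lia.
have [nu _ _] := circuit_u C.
split.
  have [na _ fa] := circuit_a C'.
  have [|||i iu [j jk aj]] := crossing (nnpath_kpath na) fa nu.
  - by move=> i iu; apply: (visits_a C'); exact: cols.
  - by move=> i ik _; rewrite u0; have [] := Ca' i ik; lia.
  - by move=> i ik _; rewrite uk; have [] := Ca' i ik; lia.
  apply: (@conn_trans _ _ (u i)).
    apply: (on_u_above_b (@conn_refl w) (@conn_trans w) C iu erefl).
    have [_] := Ca' j jk; rewrite aj; have := circuit_ucols C iu; lia.
  by rewrite -aj; apply: (a_to_e (@conn_refl w) (@conn_trans w) C').
have [nb _ fb] := circuit_b C'.
have [|||i iu [j jk aj]] := crossing (nnpath_kpath nb) fb nu.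
- by move=> i iu; apply: (visits_b C'); exact: cols.
- by move=> i ik _; rewrite u0; have := Cb' i ik; lia.
- by move=> i ik _; rewrite uk; have := Cb' i ik; lia.
apply: (@conn_trans _ _ (u i)).
  by rewrite -aj; apply: (b_from_e (@conn_refl w) (@conn_trans w) C').
apply: (on_u_below_a (@conn_refl w) (@conn_trans w) C iu erefl).
have := Cb' j jk; rewrite aj; lia.
Qed.

Lemma gigantic_of_good w (n0 : nat) :
  (forall n, (n0 <= n)%N -> good w n (1000 * n ^ 5)) ->
  has_gigantic_component (env w).
Proof.
move=> g; pose N := maxn n0 2.
have [x [a0 [b0 [u0 [ka0 [kb0 [ku0 C0]]]]]]] := @scale_circuit_exists w N ltac:(lia) (g N ltac:(lia)).
(* Chaining consecutive scales puts the ends [e] of one circuit per scale in the component of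
   [x]. *)
have CC k : exists e a b u ka kb ku, scale_circuit w (N + k) e a b u ka kb ku /\
    (conn w x e /\ conn w e x).
  elim: k => [|k [e [a [b [u [ka [kb [ku [C [xe ex]]]]]]]]]].
    by rewrite addn0; do 7 eexists; split; [exact: C0|split; exact: conn_refl].
  have [|e' [a' [b' [u' [ka' [kb' [ku' C']]]]]]] :=
    @scale_circuit_exists w (N + k).+1 ltac:(lia); first by apply: g; lia.
  have [ee' e'e] := @circuits_linked w (N + k) _ _ _ _ _ _ _ _ _ _ _ _ _ _ ltac:(lia) C C'.
  rewrite addnS; do 7 eexists; split; [exact: C'|].
  by split; [apply: conn_trans ee'|apply: conn_trans ex].
exists x; split.
  (* The ends [e] lie in columns that tend to minus infinity, so no finite list contains them
     all. *)
  move=> /finite_seqP[s sE].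
  pose B := (\sum_(z <- s) absz z.1)%N.
  have sB z : z \in s -> (absz z.1 <= B)%N.
    by move=> zs; rewrite /B (big_rem z) //= leq_addr.
  have [e [a [b [u [ka [kb [ku [[C _ _ _] xe]]]]]]]] := CC B.+1.
  have : (absz e.1 <= B)%N by apply: sB; have : mutual (env w) x e by []; rewrite sE.
  have [_ _ ->] := circuit_ends C.
  move: (N + B.+1)%N (leq_addl N B.+1) (leq_addr B.+1 N) => m Bm Nm.
  have l2 : (m <= m ^ 2)%N by rewrite -{1}[m]expn1 leq_exp2l //; lia.
  have l4 : (m ^ 2 <= m ^ 4)%N by rewrite leq_exp2l //; lia.
  by lia.
move=> y yM.
(* A scale that dominates both coordinates of [y] puts [y] inside the wedge, which its component
   cannot leave. *)
have [e [a [b [u [ka [kb [ku [[C Ca Cb [U0 Uk]] [xe ex]]]]]]]]] :=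
  CC (absz y.1 + absz y.2)%N.
set m := (N + _)%N in C Ca Cb U0 Uk.
have m2 : (2 <= m)%N by rewrite /m /N; lia.
have [my1 my2] : (absz y.1 <= m)%N /\ (absz y.2 <= m)%N by rewrite /m; lia.
clearbody m.
have l2 : (2 * m <= m ^ 2)%N by rewrite expnS expn1; nia.
have l3 : (m ^ 2 <= m ^ 4)%N by rewrite leq_exp2l //; lia.
have l5 : (m ^ 4 <= m ^ 5)%N by rewrite leq_exp2l //; lia.
apply: (@sub_finite_set _ _ [set v | inbox (1000 * m ^ 5) v]); last exact: finite_inbox.
move=> z [k [f [f0 fk fE]]].
have I0 : inside (Posz (m ^ 2) + Posz m + 1 - 8 * Posz (m ^ 4)) (Posz (m ^ 2) + Posz m + 1) a b u ka kb ku y.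
  split; first by lia.
  - by move=> i /Cb; lia.
  - by move=> i /Ca[_] + ci; rewrite ci; lia.
  - by move=> i /(circuit_ucols C) /=; lia.
have I i : (i <= k)%N -> inside (Posz (m ^ 2) + Posz m + 1 - 8 * Posz (m ^ 4)) (Posz (m ^ 2) + Posz m + 1) a b u ka kb ku (f i).
  elim: i => [|i IH] ik; first by rewrite f0.
  have [_ nM fu] := fE i ik.
  apply: (inside_step (@conn_refl w) (@conn_trans w) C (IH (ltnW ik)) (units_nn fu)).
  move=> [H1 H2]; apply: nM; split; first exact: conn_trans H1.
  exact: conn_trans ex.
have := inside_bounds C (I k (leqnn k)); rewrite fk /inbox /= U0 Uk; lia.
Qed.

(** * Five-neighbour paths as barriers *)

Lemma five_step_cases z z' : z' - z \in five_steps ->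
  king z z' /\ (z'.1 = z.1 \/ z'.1 = z.1 - 1).
Proof.
case: z z' => [c h] [c' h']; rewrite /five_steps !inE /king /=.
move=> /or4P[|||/orP[]] /eqP E; have := congr1 fst E; have := congr1 snd E; rewrite /= => E2 E1;
  (split; [lia | lia]).
Qed.

Section FiveCluster.
Variables (w : Z2 -> bool) (n : nat).
Hypotheses (n2 : (2 <= n)%N) (g : good w n (1000 * n ^ 5)).

Let p2 : (n ^ 2 = n * n)%N. Proof. by rewrite expnS expn1. Qed.
Let p3 : (n ^ 3 = n * n ^ 2)%N. Proof. by rewrite expnS. Qed.
Let l2 : (2 * n <= n ^ 2)%N. Proof. by rewrite p2 leq_mul2r n2 orbT. Qed.
Let l3 : (2 * n ^ 2 <= n ^ 3)%N. Proof. by rewrite p3 leq_mul2r n2 orbT. Qed.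
Let l5 : (n ^ 3 <= n ^ 5)%N. Proof. by rewrite leq_exp2l //; lia. Qed.

Let norun v : inbox (1000 * n ^ 5) v -> ~ (forall i, (i < n)%N -> w (v.1, v.2 + Posz i)).
Proof.
move=> vb H; have : ~~ holds w (vrun true n v).
  by apply: (good_trap (v := v) g) => //; rewrite !inE eqxx.
by move=> /allPn[x /mapP[i]]; rewrite mem_iota => ib -> /=; rewrite H //; lia.
Qed.

Variables (f : nat -> Z2) (k : nat).
Hypotheses (f0 : f 0%N = 0) (fE : forall i, (i < k)%N -> five_arc w (f i) (f i.+1)).

Let fk : kpath f k.
Proof. by move=> i /fE[_] /five_step_cases[]. Qed.

Let fcol i j : (i <= j <= k)%N -> (f j).1 <= (f i).1.
Proof.
elim: j => [|j IH] ij; first by have -> : i = 0%N by lia.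
have [->|ne] := eqVneq i j.+1; first by [].
have := IH ltac:(lia); have [_ /five_step_cases[_]] := fE (i := j) ltac:(lia).
lia.
Qed.

Let ffib : fibered f k.
Proof.
move=> i j l /andP[ij jl] lk E.
by have := @fcol i j ltac:(lia); have := @fcol j l ltac:(lia); lia.
Qed.

(** The invariant is that [f] has a point at or under the walker in its column. Downward and
    sideways moves start at vertices that are not up; these lie off [f], hence strictly over it, and
    one step cannot get past it. *)
Lemma barrier_step (s : int) v : s = 1 \/ s = -1 -> (f k).1 = - Posz (n ^ 2) - 1 ->
  - Posz (n ^ 2) <= v.1 <= 0 -> - Posz (n ^ 2) <= (step w s v).1 <= 0 ->
  (exists2 i, (i <= k)%N & (f i).1 = v.1 /\ (f i).2 <= v.2) ->
  (exists2 i, (i <= k)%N & (f i).1 = (step w s v).1 /\ (f i).2 <= (step w s v).2).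
Proof.
move=> hs fkc vc vc' [i ik [ci hi]].
have mf c : - Posz (n ^ 2) <= c <= 0 -> visits f k c.
  by move=> H; apply: visits_between_rev => //; rewrite f0 fkc /=; lia.
have [wv|wv] := boolP (w v).
  by rewrite /step wv /=; exists i => //; split=> //; lia.
(* All vertices of [f] but the last are open, and the last lies outside the columns considered. *)
have nv : ~ on f k v.
  case=> j jk fj; have [jk'|] := ltnP j k.
    by have [] := fE jk'; rewrite fj (negbTE wv).
  by move=> kj; have jk2 : j = k by [lia]; move: fkc; rewrite -jk2 fj; lia.
have av : above f k v.
  by have [//|bv] := side_cases fk ffib nv; have := bv i ik ci; lia.
move: vc'; rewrite /step (negbTE wv); case: ifP => _ /= vc'; last first.
  by exists i => //; split=> //; have := av i ik ci; lia.
have [a [b [ak bk kab ca cb]]] : exists a b, [/\ (a <= k)%N, (b <= k)%N,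
    king (f a) (f b), (f a).1 = v.1 & (f b).1 = v.1 + s].
  case: hs vc' => -> vc'; first by apply: visits_step => //; apply: mf.
  have [||b [a [bk ak kab cb ca]]] := @visits_step f k (v.1 - 1) fk; first exact: mf.
    by rewrite subrK; apply: mf.
  by exists a, b; rewrite kingC; split=> //; rewrite ca subrK.
exists b => //; split=> //.
by have := av a ak ca; move: kab; rewrite /king; lia.
Qed.

Lemma barrier_walk (s : int) v m : s = 1 \/ s = -1 -> (f k).1 = - Posz (n ^ 2) - 1 ->
  (forall i, (i <= m)%N -> - Posz (n ^ 2) <= (walk w s v i).1 <= 0) ->
  (exists2 i, (i <= k)%N & (f i).1 = v.1 /\ (f i).2 <= v.2) ->
  (exists2 i, (i <= k)%N & (f i).1 = (walk w s v m).1 /\ (f i).2 <= (walk w s v m).2).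
Proof.
move=> hs fkc; elim: m => [//|m IH] mc ev.
apply: (barrier_step hs fkc (mc m _) (mc m.+1 _)) => //.
by apply: IH => // i im; apply: mc; lia.
Qed.

(* A W-walk descends to height at most -n over n^2 columns, and an E-walk back
   to column 0 descends n more; neither can get below the path f, so f visits
   column 0 below height -n, which makes a long vertical run of open vertices. *)
Lemma five_path_no_exit : (f k).1 <> - Posz (n ^ 2) - 1.
Proof.
move=> fkc.
have s1 : (1 : int) = 1 \/ (1 : int) = -1 by left.
have sm1 : (-1 : int) = 1 \/ (-1 : int) = -1 by right.
have [||||ka [h [Wa ha Pa]]] := @walk_blocks w (-1) sm1 n (1000 * n ^ 5) n 0 0 g;
  rewrite -?p2 -?p3; [lia|lia|lia|lia|].
rewrite -?p2 -?p3 in Wa ha Pa.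
have Wa2 : walk w (-1) (0, 0) ka = (- Posz (n ^ 2), h) by rewrite Wa; congr pair; lia.
have [||||kb [h' [Wb hb Pb]]] := @walk_blocks w 1 s1 n (1000 * n ^ 5) n (- Posz (n ^ 2)) h g;
  rewrite -?p2 -?p3; [lia|lia|lia|lia|].
rewrite -?p2 -?p3 in Wb hb Pb.
have Wb' : walk w 1 (- Posz (n ^ 2), h) kb = (0, h') by rewrite Wb; congr pair; lia.
have [||i ik] := @barrier_walk (-1) (0, 0) ka sm1 fkc.
- by move=> i /Pa[] /=; lia.
- by exists 0%N; rewrite ?f0.
rewrite Wa2 /= => ci.
have [||j jk] := @barrier_walk 1 (- Posz (n ^ 2), h) kb s1 fkc.
- by move=> l /Pb[] /=; lia.
- by exists i.
rewrite Wb' /= => -[cj hj].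
apply: (@norun (0, 1 - Posz n)); first by rewrite /inbox /=; lia.
move=> l ln /=.
have [|||||m mk fm] := @kpath_hit f k (0, 1 - Posz n + Posz l) j 0 fk ffib => //.
- by rewrite f0.
- by rewrite f0 /=; lia.
have [mk'|km] := ltnP m k; first by have [] := fE mk'; rewrite fm.
by have mk2 : m = k by [lia]; move: fkc; rewrite -mk2 fm /=; lia.
Qed.

(** Within a column the path moves along open vertices, so it drifts by at most n from its entry
    height; a change of column adds at most 1. *)
Lemma five_path_height : - Posz (n ^ 2) <= (f k).1 -> inbox (1000 * n ^ 5) (f k).
Proof.
move=> kc.
have colk i : (i <= k)%N -> - Posz (n ^ 2) <= (f i).1 <= 0.
  move=> ik; have := @fcol i k ltac:(lia); have := @fcol 0 i ltac:(lia).
  by rewrite f0 /=; lia.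
have short i (y : int) : (i <= k)%N ->
    - Posz (n + 1) * - (f i).1 <= y <= Posz (n + 1) * - (f i).1 ->
    (forall t : int, (y <= t < (f i).2) || ((f i).2 < t <= y) -> w ((f i).1, t)) ->
    - Posz n <= (f i).2 - y <= Posz n.
  move=> ik yb yw; have ci := colk i ik.
  have yB : - (Posz (n ^ 3) + Posz (n ^ 2)) <= y <= Posz (n ^ 3) + Posz (n ^ 2).
    by move: p3; nia.
  apply/andP; split; rewrite leNgt; apply/negP => ny.
    apply: (@norun ((f i).1, y - Posz n + 1)); first by rewrite /inbox /=; lia.
    by move=> t tn; apply: yw => /=; lia.
  apply: (@norun ((f i).1, y)); first by rewrite /inbox /=; lia.
  by move=> t tn; apply: yw => /=; lia.
(* Here [y] is the height at which the path enters the column of [f i]. *)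
have H i : (i <= k)%N -> exists y : int,
    - Posz (n + 1) * - (f i).1 <= y <= Posz (n + 1) * - (f i).1 /\
    (forall t : int, (y <= t < (f i).2) || ((f i).2 < t <= y) -> w ((f i).1, t)).
  elim: i => [|i IH] ik.
    by exists 0; rewrite f0 /=; split; [lia | move=> t; lia].
  have [y [yb yw]] := IH (ltnW ik); have yn := short i y (ltnW ik) yb yw.
  have [wi /five_step_cases[ki [ci|ci]]] := fE ik.
    exists y; rewrite ci; split=> // t ht; have [->|ne] := eqVneq t (f i).2.
      by case: (f i) wi.
    by apply: yw; move: ki; rewrite /king; lia.
  exists (f i.+1).2; split; last by move=> t; lia.
  by move: ki yb yn; rewrite ci /king; nia.
have [y [yb yw]] := H k (leqnn k); have := short k y (leqnn k) yb yw.
by have := colk k (leqnn k); have := p3; rewrite /inbox; nia.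
Qed.

End FiveCluster.

Lemma five_cluster_finite w n : (2 <= n)%N -> good w n (1000 * n ^ 5) ->
  finite_set (five_cluster w).
Proof.
move=> n2 g; apply: (@sub_finite_set _ _ [set v | inbox (1000 * n ^ 5) v]); last exact: finite_inbox.
move=> z [k [f [f0 fk fE]]] /=; rewrite -fk.
apply: (five_path_height n2 g f0 fE); rewrite leNgt; apply/negP => lt.
(* A path that goes beyond column -n^2 visits column -n^2 - 1 and is cut there. *)
have [||i ik ci] := @int_ivt (fun i => - (f i).1) 0 k (Posz (n ^ 2) + 1) (leq0n k).
- by move=> i ik; have [_ /five_step_cases[]] := fE i ltac:(lia); rewrite /king; lia.
- by rewrite f0 /=; lia.
apply: (five_path_no_exit n2 g f0 (k := i)); last by lia.
by move=> j ji; apply: fE; lia.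
Qed.

(** * Weights of cylinder events *)

Definition wt (R : realType) (mu : bool -> R) (L : seq (Z2 * bool)) : R :=
  \prod_(x <- L) mu x.2.

Section Weights.
Variables (R : realType) (mu : bool -> R).
Let q := mu true.
Let p := mu false.

Lemma wt_cat L L' : wt mu (L ++ L') = wt mu L * wt mu L'.
Proof. by rewrite /wt big_cat. Qed.

Lemma wt_const (f : nat -> Z2) b (s : seq nat) :
  wt mu [seq (f i, b) | i <- s] = mu b ^+ size s.
Proof. by rewrite /wt big_map /= big_const_seq count_predT iter_mulr_1. Qed.

Lemma wt_upcol c h j : wt mu (upcol c h j) = q ^+ j * p.
Proof. by rewrite wt_cat wt_const size_iota /wt big_seq1. Qed.

Lemma wt_downcol c h j : wt mu (downcol c h j) = p ^+ j.+1 * q.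
Proof. by rewrite wt_cat wt_const size_iota /wt big_seq1. Qed.

Lemma wt_vrun b n v : wt mu (vrun b n v) = mu b ^+ n.
Proof. by rewrite wt_const size_iota. Qed.

Lemma wt_hrun n v : wt mu (hrun n v) = p ^+ n.
Proof. by rewrite wt_const size_iota. Qed.

Lemma geometric_sum_le (x : R) m n : 0 <= x < 1 ->
  \sum_(j <- iota m n) x ^+ j <= x ^+ m / (1 - x).
Proof.
move=> /andP[x0 x1]; have x1' : 0 < 1 - x by rewrite subr_gt0.
elim: n m => [|n IH] m; first by rewrite big_nil divr_ge0 // ?exprn_ge0 // ltW.
rewrite /= big_cons (le_trans (lerD (lexx _) (IH _))) //.
rewrite exprS le_eqVlt; apply/orP; left; apply/eqP; field.
by rewrite gt_eqF.
Qed.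

Hypotheses (p0 : 0 < p) (q0 : 0 < q).

Variable th : R.
Hypotheses (th1 : 1 < th) (qth : q * th < 1) (pth : p / th < 1).

(** The expectation of [th] to the power of the height change in one column: a geometric series for
    the upward changes and one for the others. *)
Definition mgf := p * q * th / (1 - q * th) + p * q / (1 - p / th).

Let th0 : 0 < th. Proof. exact: lt_trans th1. Qed.

Lemma mgf_ge0 : 0 <= mgf.
Proof.
by rewrite addr_ge0 // divr_ge0 ?subr_ge0 ?mulr_ge0 // ltW.
Qed.

(* Chernoff bound: with h0 the height to be reached, the potential th^(h - h0)
   dominates the indicator of {h0 <= h}, and a column multiplies it by at most
   mgf on average. *)
Lemma wt_climbs s n k c h h0 :
  \sum_(L <- climbs s n k c h h0) wt mu L <= mgf ^+ k * th ^ (h - h0).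
Proof.
elim: k c h => [|k IH] c h.
  rewrite /= expr0 mul1r; case: ifP => hh; last by rewrite big_nil exprz_ge0 ?ltW.
  rewrite big_seq1 /wt big_nil; have -> : h - h0 = Posz (absz (h - h0)) by lia.
  by rewrite exprn_ege1 ?ltW.
rewrite climbsS big_cat !big_flatten !big_map.
have thE (j : int) : th ^ (h + j - h0) = th ^ j * th ^ (h - h0).
  by rewrite -expfzDr ?gt_eqF //; congr (_ ^ _); lia.
have up : \sum_(j <- iota 1 n) \sum_(L <- [seq upcol c h j ++ L |
    L <- climbs s n k (c + s) (h + Posz j) h0]) wt mu L <=
    mgf ^+ k * th ^ (h - h0) * (p * \sum_(j <- iota 1 n) (q * th) ^+ j).
  rewrite !mulr_sumr; apply: ler_sum => j _; rewrite big_map.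
  under eq_bigr do rewrite wt_cat wt_upcol.
  rewrite -mulr_sumr; apply: le_trans (ler_wpM2l _ (IH _ _)) _.
    by rewrite mulr_ge0 ?exprn_ge0 ?ltW.
  by rewrite thE exprMn -exprnP; rewrite le_eqVlt; apply/orP; left; apply/eqP; ring.
have down : \sum_(j <- iota 0 n.+1) \sum_(L <- [seq downcol c h j ++ L |
    L <- climbs s n k (c + s) (h - Posz j) h0]) wt mu L <=
    mgf ^+ k * th ^ (h - h0) * (p * q * \sum_(j <- iota 0 n.+1) (p / th) ^+ j).
  rewrite !mulr_sumr; apply: ler_sum => j _; rewrite big_map.
  under eq_bigr do rewrite wt_cat wt_downcol.
  rewrite -mulr_sumr; apply: le_trans (ler_wpM2l _ (IH _ _)) _.
    by rewrite mulr_ge0 ?exprn_ge0 ?ltW.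
  rewrite thE exprMn exprVn -exprnN; rewrite le_eqVlt; apply/orP; left; apply/eqP.
  by rewrite exprS; move: (_ ^+ j)^-1 (th ^ _) => A B; ring.
apply: le_trans (lerD up down) _; rewrite -mulrDr exprSr [leRHS]mulrAC.
apply: ler_wpM2l; first by rewrite mulr_ge0 ?exprn_ge0 ?exprz_ge0 ?mgf_ge0 ?ltW.
apply: lerD.
  apply: le_trans (ler_wpM2l (ltW p0) (geometric_sum_le _ _ _)) _.
    by rewrite qth mulr_ge0 ?ltW.
  by rewrite expr1 !mulrA.
apply: le_trans (ler_wpM2l _ (geometric_sum_le _ _ _)) _.
- by rewrite mulr_ge0 ?ltW.
- by rewrite pth divr_ge0 ?ltW.
- by rewrite expr0 mul1r.
Qed.

Lemma zrange_size X : size (zrange X) = (2 * X).+1.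
Proof. by rewrite size_map size_iota. Qed.

(** Each of the (2X + 1)^2 vertices contributes three runs and two families of climbs, each of total
    weight at most [rho ^+ n]. *)
Lemma wt_traps n X rho : p <= rho -> q <= rho -> mgf <= rho ->
  \sum_(L <- traps n X) wt mu L <= 5 * (2 * X).+1%:R ^+ 2 * rho ^+ n.
Proof.
move=> pr qr mr; have r0 : 0 <= rho by rewrite (le_trans (ltW p0)).
have sub (x : R) : 0 <= x -> x <= rho -> x ^+ n <= rho ^+ n by move=> x0 xr; rewrite lerXn2r ?nnegrE.
rewrite /traps big_flatten big_map.
apply: (@le_trans _ _ (\sum_(v <- [seq (c, h) | c <- zrange X, h <- zrange X]) 5 * rho ^+ n)).
  apply: ler_sum => v _; rewrite big_cat /= !big_cons big_nil !big_cat /= !wt_vrun wt_hrun.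
  have cl s := le_trans (wt_climbs s n n v.1 v.2 v.2)
    (_ : mgf ^+ n * th ^ (v.2 - v.2) <= rho ^+ n).
  have {}cl s : \sum_(L <- climbs s n n v.1 v.2 v.2) wt mu L <= rho ^+ n.
    by apply: cl; rewrite subrr expr0z mulr1 sub ?mgf_ge0.
  have := sub p (ltW p0) pr; have := sub q (ltW q0) qr; have := cl 1; have := cl (-1).
  by rewrite -/p -/q; lra.
rewrite big_const_seq count_predT iter_addr_0 size_allpairs !zrange_size.
by rewrite -[leLHS]mulr_natr natrM -expr2 mulrAC.
Qed.

End Weights.

(* In terms of A = 1 - q th and B = th - p the claim reads p q th (A + B) < A B,
   and A B - p q th (A + B) = (th - 1) (p - q (1 + p^2) th). *)
Lemma mgf_lt1 (R : realType) (mu : bool -> R) : 0 < mu false < 1 ->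
  mu true = 1 - mu false ->
  0 < mu false ^+ 3 - mu false ^+ 2 + 2 * mu false - 1 ->
  exists th : R, [/\ 1 < th, mu true * th < 1, mu false / th < 1 & mgf mu th < 1].
Proof.
rewrite /mgf => /andP[]; move: (mu false) (mu true) => p q p0 p1 qE H.
have q0 : 0 < q by rewrite qE subr_gt0.
pose al := q * (1 + p ^+ 2).
have al0 : 0 < al by rewrite mulr_gt0 // ltr_pwDl ?sqr_ge0.
(* With q = 1 - p, the difference p - q (1 + p^2) is the cubic of the hypothesis. *)
have alp : al < p by rewrite /al qE -subr_gt0; move: H; rewrite !expr2 !exprS expr0; lra.
(* The harmonic mean of 1 and p / al, hence strictly between them. *)
pose th := 2 * p / (p + al).
have th1 : 1 < th by rewrite /th ltr_pdivlMr ?addr_gt0 //; lra.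
have th0 : 0 < th by apply: lt_trans th1.
have alth : al * th < p.
  by rewrite /th mulrA ltr_pdivrMr ?addr_gt0 //; nra.
have A0 : 0 < 1 - q * th.
  have : q * th < p by apply: le_lt_trans alth; rewrite ler_wpM2r ?ltW // /al; nra.
  by lra.
have B0 : 0 < th - p by lra.
exists th; split=> //; first by lra.
  by rewrite ltr_pdivrMr //; lra.
have -> : p * q * th / (1 - q * th) + p * q / (1 - p / th) =
   p * q * th * ((1 - q * th) + (th - p)) / ((1 - q * th) * (th - p)).
  by field; rewrite ?gt_eqF.
rewrite ltr_pdivrMr ?mulr_gt0 // mul1r -subr_gt0.
have -> : (1 - q * th) * (th - p) - p * q * th * ((1 - q * th) + (th - p)) =
  (th - 1) * (p - al * th) by rewrite /al qE; ring.
by rewrite mulr_gt0 // subr_gt0.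
Qed.

(* expR x >= x^10 / 10! turns the polynomial factor into a slower exponential. *)
Lemma poly_geometric_le (R : realType) (rho : R) (k : nat) : 0 < rho < 1 ->
  exists K s : R, [/\ 0 <= K, 0 < s < 1 & forall n, n%:R ^+ k.+1 * rho ^+ n <= K * s ^+ n].
Proof.
(* Half the rate: rho = exp(-c)^2, where one factor absorbs the polynomial and the other remains. *)
move=> /andP[r0 r1]; pose c := - ln rho / 2.
have c0 : 0 < c by rewrite divr_gt0 // oppr_gt0 ln_lt0 // r0.
exists (k.+1`!%:R / c ^+ k.+1), (expR (- c)); split.
- by rewrite divr_ge0 // exprn_ge0 // ltW.
- by rewrite expR_gt0 expR_lt1 oppr_lt0.
move=> n.
have rE : rho = expR (- c) * expR (- c).
  by rewrite -expRD /c -opprD -splitr opprK lnK // posrE.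
rewrite rE exprMn mulrA; apply: ler_wpM2r; first by rewrite exprn_ge0 ?expR_ge0.
rewrite -expRM_natr mulNr expRN ler_pdivrMr ?expR_gt0 //.
have x0 : 0 <= c * n%:R by rewrite mulr_ge0 // ltW.
have := expR_ge1Dxn k x0; rewrite exprMn => E.
rewrite mulrAC ler_pdivlMr ?exprn_gt0 // -ler_pdivrMl ?ltr0n ?fact_gt0 //.
by apply: le_trans E; rewrite mulrC [n%:R ^+ _ * _]mulrC lerDr.
Qed.

(** * Almost all environments are good at large scales *)

(** The product rule of [iid_family] asks for distinct vertices; under this condition [wt] is the
    probability of the cylinder. *)
Definition consistent (L : seq (Z2 * bool)) := uniq [seq x.1 | x <- L].

Lemma consistent_inj L : consistent L -> {in L &, injective fst}.
Proof.
move=> uL x y xL yL xy.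
have ix : (index x L < size L)%N by rewrite index_mem.
have iy : (index y L < size L)%N by rewrite index_mem.
have E : index x L = index y L.
  apply/eqP; rewrite -(nth_uniq x.1 _ _ uL) ?size_map //.
  by rewrite !(nth_map x) // !nth_index // xy.
by rewrite -(nth_index x xL) E nth_index.
Qed.

Lemma consistent_vrun b n v : consistent (vrun b n v).
Proof.
rewrite /consistent -map_comp map_inj_uniq ?iota_uniq // => i j /= [] /addrI.
by case.
Qed.

Lemma consistent_hrun n v : consistent (hrun n v).
Proof.
rewrite /consistent -map_comp map_inj_uniq ?iota_uniq // => i j /= [] /addrI.
by case.
Qed.

Lemma upcol_keys c h j :
  [seq x.1 | x <- upcol c h j] = [seq (c, h + Posz i) | i <- iota 0 j.+1].
Proof. by rewrite /upcol map_cat -map_comp -[in RHS]addn1 iotaD map_cat. Qed.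

Lemma downcol_keys c h j :
  [seq x.1 | x <- downcol c h j] = [seq (c, h - Posz i) | i <- iota 0 j.+2].
Proof. by rewrite /downcol map_cat -map_comp -[j.+2 in RHS]addn1 iotaD map_cat. Qed.

Lemma column_cat (s : int) (k : nat) c (A L : seq (Z2 * bool)) : s = 1 \/ s = -1 ->
  consistent A -> (forall x, x \in A -> x.1.1 = c) ->
  consistent L -> (forall x, x \in L -> 0 <= s * (x.1.1 - (c + s)) < Posz k) ->
  consistent (A ++ L) /\ (forall x, x \in A ++ L -> 0 <= s * (x.1.1 - c) < Posz k.+1).
Proof.
move=> hs uA cA uL cL; split.
  rewrite /consistent map_cat cat_uniq; apply/and3P; split=> //.
  apply/hasPn => y /mapP[x xL ->]; apply/negP => /mapP[x' x'A E].
  by have := cL x xL; rewrite E (cA _ x'A); case: hs => ->; lia.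
move=> x; rewrite mem_cat => /orP[/cA ->|/cL]; first by case: hs => ->; lia.
by case: hs => ->; lia.
Qed.

(** Each column of the walk only prescribes vertices of its own column, and no column occurs
    twice. *)
Lemma climbs_consistent (s : int) n k c h h0 L : s = 1 \/ s = -1 ->
  L \in climbs s n k c h h0 ->
  consistent L /\ forall x, x \in L -> 0 <= s * (x.1.1 - c) < Posz k.
Proof.
move=> hs; elim: k c h L => [|k IH] c h L.
  by rewrite /=; case: ifP => //; rewrite inE => _ /eqP ->.
rewrite climbsS mem_cat => /orP[] /flattenP[S /mapP[j _ ->]] /mapP[L' /IH[uL cL] ->].
  apply: column_cat => //.
    rewrite /consistent upcol_keys map_inj_uniq ?iota_uniq // => i i' [] /addrI.
    by case.
  move=> x /(map_f fst); rewrite upcol_keys => /mapP[i _ E].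
  by move: (congr1 fst E).
apply: column_cat => //.
  rewrite /consistent downcol_keys map_inj_uniq ?iota_uniq // => i i' [] /addrI /oppr_inj.
  by case.
move=> x /(map_f fst); rewrite downcol_keys => /mapP[i _ E].
by move: (congr1 fst E).
Qed.

Lemma traps_consistent n X L : L \in traps n X -> consistent L.
Proof.
move=> /flattenP[S /mapP[v _ ->]]; rewrite !mem_cat !inE => /orP[/or3P[]/eqP->|/orP[]].
- exact: consistent_vrun.
- exact: consistent_vrun.
- exact: consistent_hrun.
- by move=> /climbs_consistent[]; first left.
- by move=> /climbs_consistent[]; first right.
Qed.

Section Probability.
Variables (R : realType) (d : measure_display) (Omega : measurableType d)
  (P : probability Omega R) (mu : bool -> R) (X : Z2 -> Omega -> bool).
Hypothesis iid : iid_family P mu X.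

Lemma measurable_holds L : measurable [set w | holds (X ^~ w) L].
Proof.
have [mX _ _] := iid.
elim: L => [|x L IH]; first by rewrite [X in measurable X](_ : _ = setT) //; apply/seteqP; split.
rewrite [X in measurable X](_ : _ = [set w | X x.1 w \in [set x.2]%SET] `&` [set w | holds (X ^~ w) L]).
  by apply: measurableI.
by apply/seteqP; split => w /=; rewrite inE => /andP.
Qed.

Lemma prob_holds L : consistent L -> P [set w | holds (X ^~ w) L] = (wt mu L)%:E.
Proof.
have [mX PX indep] := iid => uL.
pose B (x : Z2) := [set b | (x, b) \in L]%SET.
rewrite [X in P X](_ : _ = [set w | forall x, x \in [seq x.1 | x <- L] -> X x w \in B x]).
  rewrite indep // /wt -prodEFin big_map big_seq [RHS]big_seq; apply: eq_bigr => x xL.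
  rewrite PX (_ : B x.1 = [set x.2]%SET) ?big_set1 //.
  apply/setP => b; rewrite !inE; apply/idP/eqP => [bL|->]; last by case: (x) xL.
  by have := consistent_inj uL bL xL erefl => <-.
apply/seteqP; split => w /=.
  move=> /allP H y /mapP[x xL ->]; rewrite inE /= (eqP (H x xL)).
  by case: (x) xL.
move=> H; apply/allP => x xL; have := H x.1 (map_f _ xL); rewrite inE => XL.
by apply/eqP; have := consistent_inj uL XL xL erefl => <-.
Qed.

Lemma measurable_has_holds LL : measurable [set w | has (holds (X ^~ w)) LL].
Proof.
elim: LL => [|L LL IH]; first by rewrite [X in measurable X](_ : _ = set0) //; apply/seteqP; split.
rewrite [X in measurable X](_ : _ = [set w | holds (X ^~ w) L] `|` [set w | has (holds (X ^~ w)) LL]).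
  by apply: measurableU => //; apply: measurable_holds.
by apply/seteqP; split => w /= /orP.
Qed.

Lemma prob_has_holds LL : {in LL, forall L, consistent L} ->
  (P [set w | has (holds (X ^~ w)) LL] <= (\sum_(L <- LL) wt mu L)%:E)%E.
Proof.
elim: LL => [|L LL IH] uL.
  rewrite big_nil [X in P X](_ : _ = set0) ?measure0 //.
  by apply/seteqP; split.
rewrite [X in P X](_ : _ = [set w | holds (X ^~ w) L] `|` [set w | has (holds (X ^~ w)) LL]); last first.
  by apply/seteqP; split => w /= /orP.
apply: le_trans (measureU2 _ _ _) _; [exact: measurable_holds|exact: measurable_has_holds|].
rewrite big_cons EFinD -prob_holds; last by apply: uL; rewrite inE eqxx.
apply: leeD => //; apply: IH.
by move=> L' L'in; apply: uL; rewrite inE L'in orbT.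
Qed.

Lemma ae_eventually_good : 0 < mu false < 1 -> mu true = 1 - mu false ->
  0 < mu false ^+ 3 - mu false ^+ 2 + 2 * mu false - 1 ->
  {ae P, forall w, exists n0, forall n, (n0 <= n)%N -> good (X ^~ w) n (1000 * n ^ 5)}.
Proof.
move=> p01 qE H; have [th [th1 qth pth mlt]] := mgf_lt1 p01 qE H.
have /andP[p0 p1] := p01; have q0 : 0 < mu true by rewrite qE subr_gt0.
have m0 := mgf_ge0 p0 q0 th1 qth pth.
pose rho := Num.max (Num.max (mu false) (mu true)) (mgf mu th).
have pr : mu false <= rho by rewrite /rho !le_max lexx.
have qr : mu true <= rho by rewrite /rho !le_max lexx orbT.
have mr : mgf mu th <= rho by rewrite /rho !le_max lexx orbT.
have rho01 : 0 < rho < 1.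
  by rewrite (lt_le_trans p0 pr) /rho !gt_max p1 mlt qE ltrBlDl ltrDr p0.
(* The box has at most (3000 n^5)^2 vertices, hence the degree 10 = [9.+1]. *)
have [K [s [K0 /andP[s0 s1] Ks]]] := poly_geometric_le 9 rho01.
(* The shift avoids scale 0, where 2000 n^5 + 1 <= 3000 n^5 fails. *)
pose F n := [set w | has (holds (X ^~ w)) (traps n.+1 (1000 * n.+1 ^ 5))].
have mF n : measurable (F n) by apply: measurable_has_holds.
have [M [M0 PF]] : exists M : R, 0 <= M /\ forall n, (P (F n) <= (M * s ^+ n)%:E)%E.
  exists (5 * 3000 ^+ 2 * K); split=> [|n].
    by apply: (mulr_ge0 _ K0); apply: mulr_ge0; [exact: ler0n | exact: sqr_ge0].
  apply: le_trans (prob_has_holds _) _; first by move=> L /traps_consistent.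
  rewrite lee_fin; apply: le_trans (wt_traps p0 q0 th1 qth pth _ _ pr qr mr) _.
  have N2 : (2 * (1000 * n.+1 ^ 5)).+1%:R ^+ 2 <= 3000 ^+ 2 * n.+1%:R ^+ 10 :> R.
    have -> : 3000 ^+ 2 * n.+1%:R ^+ 10 = (3000 * n.+1 ^ 5)%:R ^+ 2 :> R.
      by rewrite natrM exprMn natrX -exprM.
    have : ((2 * (1000 * n.+1 ^ 5)).+1 <= 3000 * n.+1 ^ 5)%N.
      by rewrite mulnA (_ : 3000 = 2 * 1000 + 1000)%N // mulnDl -addn1 leq_add2l muln_gt0 expn_gt0.
    move: (2 * _).+1 (3000 * _)%N => A B AB.
    by rewrite lerXn2r ?nnegrE ?ler_nat.
  move: (_ ^+ 2) (3000 ^+ 2) (sqr_ge0 (3000 : R)) N2 => A C C0 N2.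
  rewrite -[leLHS]mulrA -(mulrA (5 * C)) -(mulrA 5 C) ler_wpM2l //.
  apply: (@le_trans _ _ (C * n.+1%:R ^+ 10 * rho ^+ n.+1)).
    by apply: ler_wpM2r => //; rewrite exprn_ge0 // ltW //; case/andP: rho01.
  rewrite -mulrA ler_wpM2l //; apply: le_trans (Ks n.+1) _.
  apply: ler_wpM2l => //; rewrite exprS; apply: ler_piMl; [exact: exprn_ge0 (ltW s0)|exact: ltW].
have sumF : (\sum_(n <oo) P (F n) < +oo)%E.
  apply: (@le_lt_trans _ _ (M * (1 / (1 - s)))%:E); last exact: ltry.
  apply: lime_le; first by apply: is_cvg_nneseries.
  apply: nearW => n; apply: (@le_trans _ _ (\sum_(0 <= i < n) (M * s ^+ i)%:E)%E).
    by apply: lee_sum => i _; apply: PF.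
  rewrite sumEFin lee_fin -mulr_sumr; apply: ler_wpM2l => //.
  by have := @geometric_sum_le R s 0 n; rewrite expr0 /index_iota subn0 s1 (ltW s0); apply.
have N0 := lim_sup_set_cvg0 mF sumF.
exists (lim_sup_set F); split=> //.
  by apply: bigcapT_measurable => n; apply: bigcup_measurable.
(* If [F m] failed for all m >= n, every scale from n + 1 on would be good. *)
move=> w /= nG n _; apply: contrapT => nF; apply: nG.
exists n.+1 => -[//|m] nm; rewrite /good; apply/negP => Fm; apply: nF.
by exists m.
Qed.

End Probability.

(** * The theorem *)

Lemma countable_bigcup_measurable d (T : measurableType d) (U : countType) (F : U -> set T) :
  (forall x, measurable (F x)) -> measurable (\bigcup_x F x).
Proof. by move=> mF; apply: countable_bigcupT_measurable. Qed.

(** This passes from the environment to the Boolean field of up vertices. *)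
Lemma iid_family_map (R : realType) d (Omega : measurableType d) (P : probability Omega R)
    (T S : finType) (mu : T -> R) (X : Z2 -> Omega -> T) (f : T -> S) :
  iid_family P mu X ->
  iid_family P (fun s => \sum_(t | f t == s) mu t) (fun x w => f (X x w)).
Proof.
move=> [mX PX indep].
have E (B : {set S}) x : [set w | f (X x w) \in B] = [set w | X x w \in f @^-1: B].
  by apply/seteqP; split => w /=; rewrite inE.
split=> [x B|x B|s B us]; first by rewrite E.
  rewrite E PX; congr (_%:E); rewrite (partition_big f (mem B)) /=; last by move=> t; rewrite inE.
  apply: eq_bigr => b bB; apply: eq_bigl => t; rewrite inE.
  by case: eqP => [->|]; rewrite ?bB ?andbF.
rewrite (_ : [set w | _] = [set w | forall x, x \in s -> X x w \in f @^-1: B x]).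
  by rewrite indep //; apply: eq_bigr => x _; rewrite E.
by apply/seteqP; split => w /= H x /H; rewrite inE.
Qed.

Section Cluster.
Variables (d : measure_display) (Omega : measurableType d) (X : Z2 -> Omega -> bool).
Hypothesis mX : forall x (B : {set bool}), measurable [set w | X x w \in B].

(** The last step splits the event into a countable union over the penultimate vertex. *)
Lemma measurable_five_reach n y : measurable [set w | exists z : nat -> Z2,
  [/\ z 0%N = 0, z n = y & forall i, (i < n)%N -> five_arc (X ^~ w) (z i) (z i.+1)]].
Proof.
elim: n y => [|n IH] y.
  have [->|y0] := eqVneq y 0.
    rewrite (_ : [set w | _] = setT) //; apply/seteqP; split=> // w _ /=.
    by exists (fun=> 0).
  rewrite (_ : [set w | _] = set0) //; apply/seteqP; split=> // w /= [z [-> E _]].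
  by move: y0; rewrite E eqxx.
rewrite (_ : [set w | _] = \bigcup_x ([set w | exists z : nat -> Z2,
    [/\ z 0%N = 0, z n = x & forall i, (i < n)%N -> five_arc (X ^~ w) (z i) (z i.+1)]]
    `&` [set w | five_arc (X ^~ w) x y])).
  apply: countable_bigcup_measurable => x; apply: measurableI => //.
  case: (pselect (y - x \in five_steps)) => yx.
    rewrite (_ : [set w | _] = [set w | X x w \in [set true]%SET]) //.
    by apply/seteqP; split=> w /=; rewrite finset.in_set1; [case=> -> | move=> /eqP].
  by rewrite (_ : [set w | _] = set0) //; apply/seteqP; split=> // w /= [].
apply/seteqP; split=> w /=.
  move=> [z [z0 zn zE]]; exists (z n) => //; split; last by rewrite -zn; apply: zE.
  by exists z; split=> // i ik; apply: zE; exact: ltnW.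
move=> [x _ [[z [z0 zn zE]] xy]].
exists (fun i => if (i <= n)%N then z i else y); split; [by []|by rewrite ltnn|].
move=> i ik1; have [ik|ni] := ltnP i n; first by rewrite (ltnW ik); apply: zE.
by have -> : i = n by [lia]; rewrite leqnn zn.
Qed.

Lemma measurable_five_cluster_infinite :
  measurable [set w | infinite_set (five_cluster (X ^~ w))].
Proof.
have mC y : measurable [set w | five_cluster (X ^~ w) y].
  rewrite (_ : [set w | _] = \bigcup_n [set w | exists z : nat -> Z2,
    [/\ z 0%N = 0, z n = y & forall i, (i < n)%N -> five_arc (X ^~ w) (z i) (z i.+1)]]).
    by apply: bigcupT_measurable => n; apply: measurable_five_reach.
  by apply/seteqP; split=> w /= [n]; [move=> H; exists n | move=> _ H; exists n].
(* A cluster is infinite exactly when no finite list contains it, and there are countably many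
   lists. *)
rewrite (_ : [set w | _] = ~` \bigcup_(s : seq Z2) ~` \bigcup_(y : Z2)
    (if y \in s then set0 else [set w | five_cluster (X ^~ w) y])).
  apply/measurableC/countable_bigcup_measurable => s.
  by apply/measurableC/countable_bigcup_measurable => y; case: ifP.
apply/seteqP; split=> w /= H.
  move=> [s _ sw]; apply: H; apply: (@sub_finite_set _ _ [set` s]) => [y wy /=|].
    by apply: contraPT sw => ys; apply; exists y => //; rewrite (negbTE ys).
  exact: finite_seq.
move=> /finite_seqP[s sE]; apply: H; exists s => // -[y _].
case: ifPn => // /negP ys /= wy; apply: ys.
by have : five_cluster (X ^~ w) y by []; rewrite sE.
Qed.

End Cluster.

(** The cubic is positive at p = 1 - 0.4301 = 0.5699, so almost surely some scale is good and
    confines the cluster to a box. *)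
Lemma five_not_percolates (R : realType) : ~ five_percolates (4301 / 10 ^+ 4 : R).
Proof.
case=> d; case=> Om; case=> P; case=> opn; case=> iid; apply/negP; rewrite -leNgt.
set q := 4301 / 10 ^+ 4 in iid *.
have qE : q = 4301 / 10000 by rewrite /q -natrX.
rewrite measure_negligible //; first by apply: measurable_five_cluster_infinite; case: iid.
have [||| N [mN N0 sN]] := ae_eventually_good iid.
- by rewrite /bernoulli_pmf /= qE; lra.
- by rewrite /bernoulli_pmf /= qE; lra.
- by rewrite /bernoulli_pmf /= qE; lra.
exists N; split=> // w /= iw; apply: sN => /= -[n0 g].
apply: iw; apply: (@five_cluster_finite _ (maxn n0 2)); first by rewrite leq_maxr.
by apply: g; rewrite leq_maxl.
Qed.

Lemma dirset_neq : dirset [:: - e1; e1; - e2] != dirset [:: e2].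
Proof.
have u : e2 \in units by rewrite /units !inE eqxx orbT.
by apply/eqP => /setP /(_ (SeqSub u)); rewrite !inE.
Qed.

Lemma ae_gigantic (R : realType) (d : measure_display) (Omega : measurableType d)
     (P : probability Omega R) (mu : {set dir} -> R) (p : R)
     (G : Z2 -> Omega -> {set dir}) :
     is_pmf mu ->
     mu (dirset [:: - e1; e1; - e2]) = p ->
     mu (dirset [:: e2]) = 1 - p ->
     iid_family P mu G ->
     0 < p ^+ 3 - p ^+ 2 + 2 * p - 1 -> p < 1 ->
     {ae P, forall w, has_gigantic_component (G ^~ w)}.
Proof.
move=> [mu0 mu1] mT mU iid H p1.
(* For p <= 0 the cubic is at most -1. *)
have p0 : 0 < p.
  rewrite ltNge; apply/negP => p0; suff : p ^+ 3 - p ^+ 2 + 2 * p - 1 <= 0 by lra.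
  by nra.
pose f (A : {set dir}) := A == dirset [:: e2].
have iidf := iid_family_map f iid.
have mt : \sum_(t | f t == true) mu t = 1 - p.
  by rewrite (big_pred1 (dirset [:: e2])) // => t; rewrite /f eqb_id.
have mf : \sum_(t | f t == false) mu t = p.
  have := mu1; rewrite (bigID (fun t => f t == true)) /= mt => E.
  rewrite (_ : p = 1 - (1 - p)); last by lra.
  by rewrite -{1}E addrAC subrr add0r; apply: eq_bigl => t; case: (f t).
have A1 : {ae P, forall w, exists n0, forall n, (n0 <= n)%N ->
    good (fun x => f (G x w)) n (1000 * n ^ 5)}.
  by apply: (ae_eventually_good iidf); rewrite ?mt ?mf // p0.
(* Almost surely every vertex has one of the two environments. Vertices are enumerated by
   [unpickle], with the origin for codes of no vertex, to use countable intersections. *)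
have A2 : {ae P, forall w : Omega, forall n : nat,
    G (odflt (0 : Z2) (unpickle n)) w \in [set dirset [:: - e1; e1; - e2]; dirset [:: e2]]%SET}.
  apply/ae_foralln => n; set x := odflt _ _ => /=.
  have [mG PG _] := iid.
  exists [set w | G x w \in ~: [set dirset [:: - e1; e1; - e2]; dirset [:: e2]]%SET].
  split=> //; last by move=> w /= /negP; rewrite finset.in_setC.
  rewrite PG; congr (_%:E).
  move: mu1; rewrite (bigID (mem [set dirset [:: - e1; e1; - e2]; dirset [:: e2]]%SET)) /=.
  rewrite big_setU1 /= ?inE ?dirset_neq // big_set1 mT mU => E.
  rewrite (eq_bigl (fun t => t \notin [set dirset [:: - e1; e1; - e2]; dirset [:: e2]]%SET)).
    by move: E; set S := \sum_(_ | _) _ => E; lra.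
  by move=> t; rewrite finset.in_setC.
apply: filterS2 A1 A2 => w [n0 g] GTU.
rewrite (_ : G ^~ w = env (fun x => f (G x w))); first exact: gigantic_of_good g.
apply/funext => x; have := GTU (pickle x); rewrite /= pickleK /= !inE /env /f.
by move=> /orP[] /eqP ->; rewrite ?eqxx // (negbTE dirset_neq).
Qed.

Theorem theorem4p11 :
  (forall (R : realType) (d : measure_display) (Omega : measurableType d)
     (P : probability Omega R) (mu : {set dir} -> R) (p : R)
     (G : Z2 -> Omega -> {set dir}),
     is_pmf mu ->
     mu (dirset [:: - e1; e1; - e2]) = p ->
     mu (dirset [:: e2]) = 1 - p ->
     iid_family P mu G ->
     0 < p ^+ 3 - p ^+ 2 + 2 * p - 1 -> p < 1 ->
     {ae P, forall w, has_gigantic_component (G ^~ w)}) /\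
  (forall (R : realType) (pc : R),
     five_critical_value pc -> 4301 / 10 ^+ 4 <= pc).
Proof.
split; first exact: ae_gigantic.
move=> R pc [_ H]; rewrite leNgt; apply/negP => lt.
(* A critical value under 0.4301 would force percolation at 0.4301 itself. *)
have [|_ /(_ lt)] := H (4301 / 10 ^+ 4); last exact: five_not_percolates.
by apply/andP; split; lra.
Qed.
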